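(* Let $w\in S_n$ be $321$-avoiding. Then for every $\gamma\in\mathbb{Z}_{\geq0}^n$, $$g_{w,\gamma}=\#\mathrm{KKoh}(w,\gamma)=\#\widetilde{\mathrm{KKoh}}(w,\gamma),$$ and consequently $$\mathfrak G_w=\sum_{D\in\mathrm{KKoh}(D(w))}(-1)^{\#D-\ell(w)}x^{\mathrm{wt}(D)}=\sum_{D\in\widetilde{\mathrm{KKoh}}(D(w))}(-1)^{\#D-\ell(w)}x^{\mathrm{wt}(D)}.$$
   Context: $w\in S_n$ is $321$-avoiding if there are no $a<b<c$ with $w(a)>w(b)>w(c)$. $\ell$ is Coxeter length, $s_i$ the simple transposition. Grothendieck polynomials: $\mathfrak G_{w_0}=x_1^{n-1}x_2^{n-2}\cdots x_{n-1}$ for $w_0=n\,n-1\cdots 1$, and $\mathfrak G_w=\partial_i((1-x_{i+1})\mathfrak G_{ws_i})$ whenever $w(i)<w(i+1)$, where $\partial_i f=(f-s_if)/(x_i-x_{i+1})$. Grid conventions: $[n]=\{1,\dots,n\}$; box $(i,j)$ is in row $i$, column $j$, $(1,1)$ northwest, rows increase southward. For $P\subseteq[n]\times[n]$, $\mathrm{wt}(P)_i=\#\{c:(i,c)\in P\}$, $\#P$ its cardinality. Pipe dreams: label box $(i,k)$ by $i+k-1$; $\mathrm{word}(P)=(i_1,\dots,i_j)$ reads labels of boxes of $P$ right to left along rows, top row to bottom row. In the 0-Hecke monoid, $e_ue_{s_i}=e_{us_i}$ if $\ell(us_i)>\ell(u)$ and $e_u$ otherwise; the Demazure product $\delta(P)$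 satisfies $e_{s_{i_1}}\cdots e_{s_{i_j}}=e_{\delta(P)}$. Define $g_{w,\gamma}=\#\{P\subseteq[n]\times[n]:\delta(P)=w,\ \mathrm{wt}(P)=\gamma\}$. Diagrams: a labeled diagram is $D\subseteq[n]\times[n]$ whose boxes are labeled ''black'' or ''ghost''; $\mathrm{wt}(D)_i$ counts all boxes in row $i$, $\#D$ is the total number of boxes. Rothe diagram: $D(w)=\{(i,j): w_i>j,\ w^{-1}_j>i\}$. For $(i,j)\in D$ rightmost in row $i$, let $i'=\max\{r\in[i]:(r,j)\notin D\}$ (required to exist). (1) If $(i,j)$ and all $(r,j)$ with $i'+1\le r\le i$ are black: the Kohnert move outputs $D\setminus\{(i,j)\}\cup\{(i',j)\}$ with $(i',j)$ black; the K-Kohnert move outputs $D\cup\{(i',j)\}$ with $(i',j)$ black and $(i,j)$ relabeled ghost. (2) If $(i,j)$ and all $(r,j)$ with $i'+1\le r\le i$ are ghost: the ghost Kohnert move outputs $D\setminus\{(i,j)\}\cup\{(i',j)\}$ with $(i',j)$ ghost; the ghost K-Kohnert move outputs $D\cup\{(i',j)\}$ with $(i',j)$ ghost. $\mathrm{KKoh}(D)$ is the set of labeled diagrams obtainable from $D$ (all boxes initially black) by successive Kohnert and K-Kohnert moves; $\widetilde{\mathrm{KKoh}}(D)$ is the set obtainable by successive Kohnert, K-Kohnert, ghost Kohnert and ghost K-Kohnert moves. $\mathrm{KKoh}(w,\gamma)=\{D\in\mathrm{KKoh}(D(w)):\mathrm{wt}(D)=\gamma\}$ and $\widetilde{\mathrm{KKoh}}(w,\gamma)=\{D\in\widetilde{\mathrm{KKoh}}(D(w)):\mathrm{wt}(D)=\gamma\}$.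 *)

(* Defs.v *)
From HB Require Import structures.
From mathcomp Require Import all_boot all_order all_fingroup all_algebra.
From mathcomp.multinomials Require Import mpoly.
From mathcomp Require Import zify ring.

Set Implicit Arguments.
Unset Strict Implicit.
Unset Printing Implicit Defensive.

Import GRing.Theory.

Local Open Scope ring_scope.

(* Everything is indexed from 0: rows, columns, variables, and the positions and
   values of permutations are shifted down by 1. *)

Section Simple.
Variable m : nat.
Implicit Types (i j : 'I_m.-1) (u : 'S_m).

Fact sright_subproof i : (i.+1 < m)%N.
Proof. by have := ltn_ord i; lia. Qed.

Definition sleft i : 'I_m := widen_ord (leq_pred m) i.
Definition sright i : 'I_m := Ordinal (sright_subproof i).

Definition simple i : 'S_m := tperm (sleft i) (sright i).

(* The product u s_i, i.e. x |-> u (s_i x): the group law of 'S_m is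
   (s * t) x = t (s x), so s_i is written on the left. *)
Definition rmul_simple u i : 'S_m := (simple i * u)%g.

Definition simple_prod (s : seq 'I_m.-1) : 'S_m := foldl rmul_simple 1%g s.

Definition ninv u : nat :=
  #|[set p : 'I_m * 'I_m | (p.1 < p.2)%N && (u p.2 < u p.1)%N]|.

Lemma rmul_simpleE u i x : rmul_simple u i x = u (simple i x).
Proof. by rewrite /rmul_simple permM. Qed.

Lemma rmul_simpleK u i : rmul_simple (rmul_simple u i) i = u.
Proof. by apply/permP => x; rewrite !rmul_simpleE /simple tpermK. Qed.

Lemma sleft_neq_sright i : sleft i != sright i.
Proof. by rewrite -val_eqE /=; lia. Qed.

Lemma simple_comm i j : (i.+1 < j)%N -> (simple i * simple j = simple j * simple i)%g.
Proof.
move=> ij; rewrite conjgC; congr (_ * _)%g; rewrite /simple tpermJ.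
by congr tperm; rewrite tpermD // -val_eqE /=; lia.
Qed.

Lemma simple_braid i j : (j = i.+1 :> nat)%N ->
  (simple i * simple j * simple i = simple j * simple i * simple j)%g.
Proof.
move=> ij; have e : sleft j = sright i by apply: val_inj.
transitivity (simple j ^ simple i)%g.
  by rewrite conjgE {3}/simple tpermV -/(simple i) mulgA.
transitivity (simple i ^ simple j)%g; last first.
  by rewrite conjgE {1}/simple tpermV -/(simple j) mulgA.
have nl : sleft i != sright j by rewrite -val_eqE /=; lia.
rewrite /simple !tpermJ e tpermR tpermL.
rewrite [tperm (sleft i) (sright i) (sright j)]tpermD ?[tperm (sright i) (sright j) (sleft i)]tpermD //.
all: by rewrite -val_eqE /=; lia.
Qed.

Lemma ninv_asc u i : (u (sleft i) < u (sright i))%N ->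
  ninv (rmul_simple u i) = (ninv u).+1.
Proof.
move=> asc; rewrite /ninv.
pose f (p : 'I_m * 'I_m) := (simple i p.1, simple i p.2).
have fK : cancel f f by move=> [a b]; rewrite /f /simple /= !tpermK.
set I1 := [set p | _]; set I0 := [set p | _].
have -> : I1 = (sleft i, sright i) |: (f @: I0).
  apply/setP => -[a b]; rewrite in_setU1.
  have -> : ((a, b) \in f @: I0) = (f (a, b) \in I0).
    by rewrite -{1}[(a, b)]fK (mem_imset _ _ (can_inj fK)).
  rewrite !inE /= !rmul_simpleE xpair_eqE.
  have sl : simple i (sleft i) = sright i by rewrite /simple tpermL.
  have sr : simple i (sright i) = sleft i by rewrite /simple tpermR.
  have [->|na] := eqVneq a (sleft i).
    have [->|nb] := eqVneq b (sright i).
      by rewrite sl sr /=; move: asc; lia.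
    rewrite /= sl; case: (eqVneq b (sleft i)) => [->|nb'].
      by rewrite sl /=; lia.
    have -> : simple i b = b by rewrite /simple tpermD // eq_sym.
    by congr (_ && _); move: nb nb'; rewrite -!val_eqE /=; lia.
  rewrite /=; have [->|na'] := eqVneq a (sright i).
    rewrite sr; case: (eqVneq b (sleft i)) => [->|nb].
      by rewrite sl /=; move: asc; lia.
    case: (eqVneq b (sright i)) => [->|nb']; first by rewrite sr /=; lia.
    have -> : simple i b = b by rewrite /simple tpermD // eq_sym.
    by congr (_ && _); move: nb nb'; rewrite -!val_eqE /=; lia.
  have -> : simple i a = a by rewrite /simple tpermD // eq_sym.
  congr (_ && _); case: (eqVneq b (sleft i)) => [->|nb].
    by rewrite sl; move: na na'; rewrite -!val_eqE /=; lia.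
  case: (eqVneq b (sright i)) => [->|nb'].
    by rewrite sr; move: na na'; rewrite -!val_eqE /=; lia.
  by have -> : simple i b = b by rewrite /simple tpermD // eq_sym.
rewrite cardsU1 (card_imset _ (can_inj fK)) -[X in X \in _]fK.
rewrite (mem_imset _ _ (can_inj fK)) inE /=.
by rewrite /simple tpermL tpermR /= ltnNge leqnSn.
Qed.

Lemma ninv_desc u i : (u (sright i) < u (sleft i))%N ->
  ninv u = (ninv (rmul_simple u i)).+1.
Proof.
move=> d; rewrite -{1}[u](rmul_simpleK u i) ninv_asc // !rmul_simpleE.
by rewrite /simple tpermL tpermR.
Qed.

Lemma asc_or_desc u i :
  (u (sleft i) < u (sright i))%N \/ (u (sright i) < u (sleft i))%N.
Proof.
have : u (sleft i) != u (sright i) by rewrite (inj_eq perm_inj) sleft_neq_sright.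
by rewrite -val_eqE /=; lia.
Qed.

Lemma ninv1 : ninv 1%g = 0%N.
Proof.
by apply/eqP; rewrite cards_eq0; apply/eqP/setP => p; rewrite !inE !perm1; lia.
Qed.

Lemma no_desc u : (forall i, (u (sleft i) < u (sright i))%N) -> u = 1%g.
Proof.
move=> mon.
have mono k : forall a b : 'I_m, (b = a + k.+1 :> nat)%N -> (u a < u b)%N.
  elim: k => [|k IH] a b eb.
    have ai : (a < m.-1)%N by have := ltn_ord b; lia.
    have := mon (Ordinal ai).
    have -> : sleft (Ordinal ai) = a by apply: val_inj.
    by have -> : sright (Ordinal ai) = b by apply: val_inj => /=; lia.
  have ai : (a < m.-1)%N by have := ltn_ord b; lia.
  apply: ltn_trans (IH (sright (Ordinal ai)) b _); last by rewrite /=; lia.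
  have := mon (Ordinal ai).
  by have -> : sleft (Ordinal ai) = a by apply: val_inj.
have lt (a b : 'I_m) : (a < b)%N -> (u a < u b)%N.
  by move=> ab; apply: (mono (b - a).-1); lia.
have ge (a : 'I_m) : (a <= u a)%N.
  case: a => k; elim: k => [//|k IH] km.
  have km' : (k < m)%N by lia.
  by have := IH km'; have := lt (Ordinal km') (Ordinal km) (ltnSn k) => /=; lia.
have gei k (a : 'I_m) : (k <= m - a)%N -> (m - k <= a)%N -> (u a <= a)%N.
  elim: k a => [|k IH] a k1 k2; first by have := ltn_ord a; lia.
  case: (leqP (m - k) a) => ak; first by apply: IH => //; lia.
  case: (ltnP a.+1 m) => am; last by have := ltn_ord (u a); lia.
  have := IH (Ordinal am); have := lt a (Ordinal am) (ltnSn a) => /=; lia.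
apply/permP => a; rewrite perm1; apply: val_inj; apply/eqP.
rewrite eqn_leq ge andbT; apply: (gei (m - a)%N) => //.
by have := ltn_ord a; lia.
Qed.

Lemma ninv_word u : exists2 s, size s = ninv u & simple_prod s = u.
Proof.
have [k] := ubnP (ninv u); elim: k u => // k IH u ku.
case: (pickP (fun i => u (sright i) < u (sleft i))%N) => [i di|nd].
  have e := ninv_desc di.
  have [|s ss su] := IH (rmul_simple u i); first by lia.
  exists (rcons s i); first by rewrite size_rcons ss e.
  by rewrite /simple_prod foldl_rcons -/(simple_prod s) su rmul_simpleK.
have -> : u = 1%g.
  by apply: no_desc => i; have := nd i; case: (asc_or_desc u i) => // ->.
by exists [::]; rewrite ?ninv1.
Qed.

Lemma ninv_simple_prod s : (ninv (simple_prod s) <= size s)%N.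
Proof.
elim/last_ind: s => [|s i IH]; first by rewrite /simple_prod /= ninv1.
rewrite /simple_prod foldl_rcons -/(simple_prod s) size_rcons.
by case: (asc_or_desc (simple_prod s) i) => [/ninv_asc|/ninv_desc]; lia.
Qed.

Fact has_word u : exists k : nat, [exists s : k.-tuple 'I_m.-1, simple_prod s == u].
Proof.
have [s _ su] := ninv_word u; exists (size s).
by apply/existsP; exists (in_tuple s); rewrite su.
Qed.

Definition coxlen u : nat := ex_minn (has_word u).

Lemma coxlenE u : coxlen u = ninv u.
Proof.
rewrite /coxlen; case: ex_minnP => k /existsP[t /eqP tu] kmin.
apply/eqP; rewrite eqn_leq; apply/andP; split.
  have [s ss su] := ninv_word u; rewrite -ss; apply: kmin.
  by apply/existsP; exists (in_tuple s); rewrite su.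
by rewrite -tu (leq_trans (ninv_simple_prod t)) ?size_tuple.
Qed.

End Simple.

Definition avoids321 (n : nat) (w : 'S_n) : Prop :=
  ~ exists a b c : 'I_n,
      [/\ (a < b)%N, (b < c)%N, (w b < w a)%N & (w c < w b)%N].

Section BraidAlgebra.
Variable R : idomainType.
Implicit Types x y z t : R.

Fact comm_alg x y z t (f sf rf srf A B sB rA AB BA : R) :
  x - y != 0 -> z - t != 0 ->
  (x - y) * A = (1 - y) * f - (1 - x) * sf ->
  (z - t) * B = (1 - t) * f - (1 - z) * rf ->
  (z - t) * sB = (1 - t) * sf - (1 - z) * srf ->
  (x - y) * rA = (1 - y) * rf - (1 - x) * srf ->
  (x - y) * AB = (1 - y) * B - (1 - x) * sB ->
  (z - t) * BA = (1 - t) * A - (1 - z) * rA ->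
  AB = BA.
Proof.
move=> xy zt eA eB esB erA eAB eBA.
apply: (mulfI xy); apply: (mulfI zt).
transitivity ((1 - y) * ((z - t) * B) - (1 - x) * ((z - t) * sB)).
  by rewrite eAB; ring.
transitivity ((1 - t) * ((x - y) * A) - (1 - z) * ((x - y) * rA)).
  by rewrite eA eB esB erA; ring.
transitivity ((x - y) * ((z - t) * BA)); last by ring.
by rewrite eBA; ring.
Qed.

Fact sym_alg x y (f sf A sA : R) : x - y != 0 ->
  (x - y) * A = (1 - y) * f - (1 - x) * sf ->
  (y - x) * sA = (1 - x) * sf - (1 - y) * f -> sA = A.
Proof.
move=> xy eA esA; apply: (mulfI xy); rewrite eA.
by transitivity (- ((y - x) * sA)); [ring | rewrite esA; ring].
Qed.

Fact braid_alg x y z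
  (f sf tf stf tsf tstf A B tA sB stA tsB AB BA tAB sBA ABA BAB : R) :
  x - y != 0 -> x - z != 0 -> y - z != 0 ->
  (x - y) * A = (1 - y) * f - (1 - x) * sf ->
  (y - z) * B = (1 - z) * f - (1 - y) * tf ->
  (x - z) * sB = (1 - z) * sf - (1 - x) * stf ->
  (x - z) * tA = (1 - z) * tf - (1 - x) * tsf ->
  (x - y) * tsB = (1 - y) * tsf - (1 - x) * tstf ->
  (y - z) * stA = (1 - z) * stf - (1 - y) * tstf ->
  (x - y) * AB = (1 - y) * B - (1 - x) * sB ->
  (y - z) * BA = (1 - z) * A - (1 - y) * tA ->
  (x - z) * tAB = (1 - z) * B - (1 - x) * tsB ->
  (x - z) * sBA = (1 - z) * A - (1 - x) * stA ->
  (x - y) * ABA = (1 - y) * BA - (1 - x) * sBA ->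
  (y - z) * BAB = (1 - z) * AB - (1 - y) * tAB ->
  ABA = BAB.
Proof.
move=> xy xz yz eA eB esB etA etsB estA eAB eBA etAB esBA eABA eBAB.
apply: (mulfI xy); apply: (mulfI xz); apply: (mulfI yz).
transitivity ((1 - z) ^+ 2 * ((x - y) * A) - (1 - y) ^+ 2 * ((x - z) * tA)
    + (1 - x) ^+ 2 * ((y - z) * stA)).
  transitivity ((1 - y) * (x - z) * ((y - z) * BA)
      - (1 - x) * (y - z) * ((x - z) * sBA)); first by rewrite eABA; ring.
  by rewrite eBA esBA; ring.
transitivity ((1 - z) * (1 - y) * ((y - z) * B)
    - (1 - z) * (1 - x) * ((x - z) * sB)
    + (1 - y) * (1 - x) * ((x - y) * tsB)).
  by rewrite eA eB etA estA esB etsB; ring.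
transitivity ((x - y) * ((x - z) * ((y - z) * BAB))); last by ring.
rewrite eBAB.
transitivity ((1 - z) * (x - z) * ((x - y) * AB)
    - (1 - y) * (x - y) * ((x - z) * tAB)); last by ring.
by rewrite eAB etAB; ring.
Qed.

End BraidAlgebra.

Section Grothendieck.
Variable n : nat.
Implicit Types (i j : 'I_n.-1) (f g : {mpoly int[n]}) (w : 'S_n).

Lemma msym_tpermX (s : 'S_n) (k : 'I_n) : msym s ('X_k : {mpoly int[n]}) = 'X_(s k).
Proof.
rewrite msymX; congr mpolyX; apply/mnmP => l.
rewrite mnmE !mnm1E; congr nat_of_bool.
by apply/eqP/eqP => [->|<-]; rewrite ?permKV ?permK.
Qed.

Lemma msym_simpleL i : msym (simple i) ('X_(sleft i) : {mpoly int[n]}) = 'X_(sright i).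
Proof. by rewrite msym_tpermX /simple tpermL. Qed.

Lemma msym_simpleR i : msym (simple i) ('X_(sright i) : {mpoly int[n]}) = 'X_(sleft i).
Proof. by rewrite msym_tpermX /simple tpermR. Qed.

Fact ddiff_exists i f :
  exists q : {mpoly int[n]},
    ('X_(sleft i) - 'X_(sright i)) * q == f - msym (simple i) f.
Proof.
pose D : {mpoly int[n]} := 'X_(sleft i) - 'X_(sright i).
pose P f := exists q, D * q == f - msym (simple i) f.
have PM g h : P g -> P h -> P (g * h).
  move=> [a /eqP ha] [b /eqP hb]; exists (a * h + msym (simple i) g * b).
  apply/eqP; rewrite msymM.
  transitivity ((D * a) * h + msym (simple i) g * (D * b)); first by ring.
  by rewrite ha hb; ring.
have PX (k : 'I_n) : P 'X_k.
  rewrite /P msym_tpermX /simple; case: tpermP => [->|->|_ _].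
  - by exists 1; rewrite mulr1.
  - by exists (-1); rewrite mulrN1 opprB.
  - by exists 0; rewrite mulr0 subrr.
have P1 : P 1 by exists 0; rewrite mulr0 msym1 subrr.
have PXm m : P 'X_[m].
  rewrite mpolyXE_id; apply: (big_ind P) => // k _.
  elim: (m k) => [|e IH]; first by rewrite expr0.
  by rewrite exprS; apply: PM.
elim/mpolyind: f => [|c m p _ _ [q /eqP hq]].
  by exists 0; rewrite mulr0 msym0 subrr.
have [r /eqP hr] := PXm m; exists (c *: r + q); apply/eqP.
rewrite mulrDr -scalerAr [_ * r]hr hq msymD msymZ scalerBr.
by rewrite opprD addrACA.
Qed.

(* (f - s_i f) / (x_i - x_{i+1}); the quotient is unique, {mpoly int[n]} being
   an integral domain. *)
Definition ddiff i f : {mpoly int[n]} := xchoose (ddiff_exists i f).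

Lemma ddiffE i f :
  ('X_(sleft i) - 'X_(sright i)) * ddiff i f = f - msym (simple i) f.
Proof. exact/eqP/(xchooseP (ddiff_exists i f)). Qed.

Definition w0 : 'S_n := perm (@rev_ord_inj n).

Definition is_grothendieck (G : {ffun 'S_n -> {mpoly int[n]}}) : bool :=
  (G w0 == \prod_(i < n) 'X_i ^+ (n - i.+1))
  && [forall w : 'S_n, forall i : 'I_n.-1,
        (w (sleft i) < w (sright i))%N
        ==> (G w == ddiff i ((1 - 'X_(sright i)) * G (rmul_simple w i)))].

(* The recursion is consistent because the operators
   f |-> ddiff i ((1 - x_{i+1}) f) satisfy the braid relations. *)

Section Consistency.
Variable op : 'I_n.-1 -> {mpoly int[n]} -> {mpoly int[n]}.
Hypothesis opE : forall i f, ('X_(sleft i) - 'X_(sright i)) * op i f =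
  (1 - 'X_(sright i)) * f - (1 - 'X_(sleft i)) * msym (simple i) f.
Variable start : {mpoly int[n]}.

Let mpolyX_sub_neq0 (a b : 'I_n) : a != b -> ('X_a - 'X_b : {mpoly int[n]}) != 0.
Proof.
move=> ab; rewrite subr_eq0; apply/negP => /eqP /(congr1 (mcoeff U_(a))).
rewrite !mcoeffXU eqxx eq_sym (negPf ab).
by move/eqP.
Qed.

Let msym_eq (r : 'S_n) (x y g h k : {mpoly int[n]}) :
  (x - y) * g = (1 - y) * h - (1 - x) * k ->
  (msym r x - msym r y) * msym r g
    = (1 - msym r y) * msym r h - (1 - msym r x) * msym r k.
Proof.
move/(congr1 (msym r)); rewrite [msym r (_ - _)]msymB !msymM.
by rewrite (msymB r x) (msymB r 1 y) (msymB r 1 x) msym1.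
Qed.

Let op_comm i j f : (i.+1 < j)%N -> op i (op j f) = op j (op i f).
Proof.
move=> ij.
have fx k (e : 'I_n) : e != sleft k -> e != sright k ->
    msym (simple k) ('X_e : {mpoly int[n]}) = 'X_e.
  by move=> *; rewrite msym_tpermX /simple tpermD // eq_sym.
set x : {mpoly int[n]} := 'X_(sleft i); set y : {mpoly int[n]} := 'X_(sright i).
set z : {mpoly int[n]} := 'X_(sleft j); set t : {mpoly int[n]} := 'X_(sright j).
set s := simple i; set r := simple j.
have sz : msym s z = z by apply: fx => //; rewrite -val_eqE /=; lia.
have st : msym s t = t by apply: fx => //; rewrite -val_eqE /=; lia.
have rx : msym r x = x by apply: fx => //; rewrite -val_eqE /=; lia.
have ry : msym r y = y by apply: fx => //; rewrite -val_eqE /=; lia.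
have src : msym r (msym s f) = msym s (msym r f).
  rewrite -!msymMm; congr (msym _ f); exact: simple_comm.
have xy : x - y != 0 by apply: mpolyX_sub_neq0; apply: sleft_neq_sright.
have zt : z - t != 0 by apply: mpolyX_sub_neq0; apply: sleft_neq_sright.
have e1 : (z - t) * msym s (op j f) =
    (1 - t) * msym s f - (1 - z) * msym s (msym r f).
  by have := msym_eq s (opE j f); rewrite -/z -/t -/r sz st.
have e2 : (x - y) * msym r (op i f) =
    (1 - y) * msym r f - (1 - x) * msym s (msym r f).
  by have := msym_eq r (opE i f); rewrite -/x -/y -/s rx ry src.
exact: (comm_alg xy zt (opE i f) (opE j f) e1 e2 (opE i (op j f)) (opE j (op i f))).
Qed.

Let op_braid i j f : (j = i.+1 :> nat)%N ->
  op i (op j (op i f)) = op j (op i (op j f)).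
Proof.
move=> ij.
have yy : sleft j = sright i by apply: val_inj.
set x : {mpoly int[n]} := 'X_(sleft i); set y : {mpoly int[n]} := 'X_(sright i).
set z : {mpoly int[n]} := 'X_(sright j).
set s := simple i; set t := simple j.
have sx : msym s x = y by exact: msym_simpleL.
have sy : msym s y = x by exact: msym_simpleR.
have ty : msym t y = z by rewrite /y -yy; exact: msym_simpleL.
have tz : msym t z = y by rewrite /y -yy; exact: msym_simpleR.
have sz : msym s z = z.
  by rewrite msym_tpermX /s /simple tpermD // -val_eqE /=; lia.
have tx : msym t x = x.
  by rewrite msym_tpermX /t /simple tpermD // -val_eqE /=; lia.
have br : msym s (msym t (msym s f)) = msym t (msym s (msym t f)).
  rewrite -!msymMm; congr (msym _ f).
  by rewrite !mulgA; apply: simple_braid.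
have xy : x - y != 0 by apply: mpolyX_sub_neq0; rewrite -val_eqE /=; lia.
have yz : y - z != 0 by apply: mpolyX_sub_neq0; rewrite -val_eqE /=; lia.
have xz : x - z != 0 by apply: mpolyX_sub_neq0; rewrite -val_eqE /=; lia.
have A h : (x - y) * op i h = (1 - y) * h - (1 - x) * msym s h by exact: opE.
have B h : (y - z) * op j h = (1 - z) * h - (1 - y) * msym t h.
  by have := opE j h; rewrite yy.
have ss h : msym s (msym s h) = h by rewrite -msymMm /s /simple tperm2 msym1m.
have tt h : msym t (msym t h) = h by rewrite -msymMm /t /simple tperm2 msym1m.
have sA h : msym s (op i h) = op i h.
  have e := msym_eq s (A h); rewrite sx sy ss in e.
  exact: (sym_alg xy (A h) e).
have tB h : msym t (op j h) = op j h.
  have e := msym_eq t (B h); rewrite ty tz tt in e.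
  exact: (sym_alg yz (B h) e).
have sB : (x - z) * msym s (op j f) = (1 - z) * msym s f - (1 - x) * msym s (msym t f).
  by have := msym_eq s (B f); rewrite sy sz.
have tA : (x - z) * msym t (op i f) = (1 - z) * msym t f - (1 - x) * msym t (msym s f).
  by have := msym_eq t (A f); rewrite tx ty.
have tsB : (x - y) * msym t (msym s (op j f)) =
    (1 - y) * msym t (msym s f) - (1 - x) * msym t (msym s (msym t f)).
  by have := msym_eq t sB; rewrite tx tz.
have stA : (y - z) * msym s (msym t (op i f)) =
    (1 - z) * msym s (msym t f) - (1 - y) * msym t (msym s (msym t f)).
  by have := msym_eq s tA; rewrite sx sz br.
have tAB : (x - z) * msym t (op i (op j f)) =
    (1 - z) * op j f - (1 - x) * msym t (msym s (op j f)).
  by have := msym_eq t (A (op j f)); rewrite tx ty tB.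
have sBA : (x - z) * msym s (op j (op i f)) =
    (1 - z) * op i f - (1 - x) * msym s (msym t (op i f)).
  by have := msym_eq s (B (op i f)); rewrite sy sz sA.
exact: (braid_alg xy xz yz (A f) (B f) sB tA tsB stA (A (op j f)) (B (op i f))
  tAB sBA (A (op j (op i f))) (B (op i (op j f)))).
Qed.

Let asc w i := (w (sleft i) < w (sright i))%N.

Let Gf := fix Gf (k : nat) (w : 'S_n) : {mpoly int[n]} :=
  if k is k'.+1 then
    if [pick i | asc w i] is Some i then op i (Gf k' (rmul_simple w i)) else start
  else start.

Let G w := Gf (n * n - ninv w)%N w.

Let ninv_le w : (ninv w <= n * n)%N.
Proof. by rewrite (leq_trans (max_card _)) // card_prod card_ord. Qed.

Let rmulL w i : rmul_simple w i (sleft i) = w (sright i).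
Proof. by rewrite rmul_simpleE /simple tpermL. Qed.

Let rmulR w i : rmul_simple w i (sright i) = w (sleft i).
Proof. by rewrite rmul_simpleE /simple tpermR. Qed.

Let rmulD w i e : e != sleft i -> e != sright i -> rmul_simple w i e = w e.
Proof. by move=> *; rewrite rmul_simpleE /simple tpermD // eq_sym. Qed.

Let G_pick w i : [pick i | asc w i] = Some i -> G w = op i (G (rmul_simple w i)).
Proof.
move=> p; have a : asc w i by move: p; case: pickP => // ? ? [<-].
have e := ninv_asc a; have := ninv_le (rmul_simple w i); rewrite /G e => le.
have -> : (n * n - ninv w = (n * n - (ninv w).+1).+1)%N by lia.
by rewrite /= p.
Qed.

Let G_rec w i : asc w i -> G w = op i (G (rmul_simple w i)).
Proof.
have [k] := ubnP (n * n - ninv w)%N; elim: k w i => // k IH w i wk ai.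
case E : [pick i | asc w i] => [i0|]; last first.
  by move: E; case: pickP => // /(_ i); rewrite ai.
have a0 : asc w i0 by move: E; case: pickP => // ? ? [<-].
rewrite (G_pick E) {E}.
have IHs w' j : (ninv w < ninv w')%N -> asc w' j -> G w' = op j (G (rmul_simple w' j)).
  by move=> lt; apply: IH; have := ninv_le w'; lia.
clear IH wk k.
wlog lt : i i0 ai a0 / (i < i0)%N.
  move=> H; case: (ltngtP i i0) => [lt|lt|/val_inj -> //]; first exact: H.
  by symmetry; apply: H.
have n1 := ninv_asc ai; have n2 := ninv_asc a0.
case: (ltnP i.+1 i0) => far.
  have b1 : asc (rmul_simple w i) i0.
    by rewrite /asc !rmulD // -val_eqE /=; lia.
  have b2 : asc (rmul_simple w i0) i.
    by rewrite /asc !rmulD // -val_eqE /=; lia.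
  rewrite (IHs _ _ _ b1) ?n1 // (IHs _ _ _ b2) ?n2 // -op_comm //.
  by rewrite /rmul_simple !mulgA (simple_comm far).
have adj : (i0 = i.+1 :> nat)%N by lia.
have m0 : sleft i0 = sright i by apply: val_inj.
have lr : sleft i != sleft i0 by rewrite -val_eqE /=; lia.
have lr' : sleft i != sright i0 by rewrite -val_eqE /=; lia.
have rl : sright i0 != sright i by rewrite -val_eqE /=; lia.
have rl' : sright i0 != sleft i by rewrite -val_eqE /=; lia.
have trans : (w (sleft i) < w (sright i0))%N.
  by apply: ltn_trans ai _; rewrite -m0.
have b1 : asc (rmul_simple w i) i0 by rewrite /asc m0 rmulR rmulD.
have b2 : asc (rmul_simple w i0) i by rewrite /asc -m0 rmulL rmulD.
have n3 := ninv_asc b1; have n4 := ninv_asc b2.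
have c1 : asc (rmul_simple (rmul_simple w i) i0) i.
  by rewrite /asc (rmulD _ lr lr') rmulL -m0 rmulL (rmulD _ rl' rl).
have c2 : asc (rmul_simple (rmul_simple w i0) i) i0.
  by rewrite /asc (rmulD _ rl' rl) rmulR m0 rmulR (rmulD _ lr lr').
rewrite (IHs _ _ _ b1) ?n1 // (IHs _ _ _ b2) ?n2 //.
rewrite (IHs _ _ _ c1) ?n3 ?n1 // (IHs _ _ _ c2) ?n4 ?n2 // -op_braid //.
by rewrite /rmul_simple !mulgA (simple_braid adj).
Qed.

Fact consistent : exists G : 'S_n -> {mpoly int[n]}, G w0 = start /\
  forall w i, (w (sleft i) < w (sright i))%N -> G w = op i (G (rmul_simple w i)).
Proof.
exists G; split; last exact: G_rec.
rewrite /G; case: (n * n - _)%N => [//|k] /=.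
by case: pickP => // i; rewrite /asc !permE /=; have := ltn_ord i; lia.
Qed.

End Consistency.

Fact grothendieck_exists : exists G, is_grothendieck G.
Proof.
have opE i f : ('X_(sleft i) - 'X_(sright i)) * ddiff i ((1 - 'X_(sright i)) * f) =
    (1 - 'X_(sright i)) * f - (1 - 'X_(sleft i)) * msym (simple i) f.
  by rewrite ddiffE msymM msymB msym1 msym_simpleR.
have [G [G0 Gr]] := consistent opE (\prod_(i < n) 'X_i ^+ (n - i.+1)).
exists [ffun w => G w]; apply/andP; split; first by rewrite ffunE G0.
apply/forallP => w; apply/forallP => i; apply/implyP => a.
by rewrite !ffunE (Gr _ _ a).
Qed.

(* The family is unique, by descending induction on coxlen w. *)
Definition Grothendieck : {ffun 'S_n -> {mpoly int[n]}} := xchoose grothendieck_exists.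

Lemma Grothendieck_w0 : Grothendieck w0 = \prod_(i < n) 'X_i ^+ (n - i.+1).
Proof. by have /andP[/eqP] := xchooseP grothendieck_exists. Qed.

Lemma Grothendieck_rec w i : (w (sleft i) < w (sright i))%N ->
  Grothendieck w = ddiff i ((1 - 'X_(sright i)) * Grothendieck (rmul_simple w i)).
Proof.
have /andP[_ /forallP/(_ w)/forallP/(_ i)/implyP H] := xchooseP grothendieck_exists.
by move=> a; apply/eqP/H.
Qed.

End Grothendieck.

Section PipeDreams.
Variable n : nat.
Implicit Types (P : {set 'I_n * 'I_n}) (w : 'S_n).

Definition wt P : 'X_{1..n} := [multinom #|[set c | (i, c) \in P]| | i < n].

Fact box_label_subproof (b : 'I_n * 'I_n) : (b.1 + b.2 < (n + n).-1)%N.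
Proof. by have := ltn_ord b.1; have := ltn_ord b.2; lia. Qed.

(* The labels of boxes of [n] x [n] range over 1, ..., 2n-1, so the Demazure
   product is computed in S_{2n}. *)
Definition box_label (b : 'I_n * 'I_n) : 'I_(n + n).-1 :=
  Ordinal (box_label_subproof b).

Definition pd_word P : seq 'I_(n + n).-1 :=
  [seq box_label b
     | b <- [seq (i, k) | i <- enum 'I_n, k <- rev (enum 'I_n)] & b \in P].

Definition hecke_mul m (u : 'S_m) (i : 'I_m.-1) : 'S_m :=
  if (coxlen u < coxlen (rmul_simple u i))%N then rmul_simple u i else u.

Definition demazure P : 'S_(n + n) := foldl (@hecke_mul (n + n)) 1%g (pd_word P).

Definition extend_fun w (x : 'I_(n + n)) : 'I_(n + n) :=
  match split x with
  | inl i => lshift n (w i)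
  | inr i => rshift n i
  end.

Fact extend_inj w : injective (extend_fun w).
Proof.
move=> x y; rewrite -[x]splitK -[y]splitK /extend_fun !unsplitK.
case: (split x) => a; case: (split y) => b /=.
- by move/lshift_inj/perm_inj->.
- by move/eqP; rewrite eq_lrshift.
- by move/eqP; rewrite eq_rlshift.
- by move/rshift_inj->.
Qed.

(* The standard embedding of S_n into S_{2n}. *)
Definition extend w : 'S_(n + n) := perm (@extend_inj w).

Definition gcoef w (gamma : 'X_{1..n}) : nat :=
  #|[set P | (demazure P == extend w) && (wt P == gamma)]|.

End PipeDreams.

Definition label := bool.
Definition black : label := true.
Definition ghost : label := false.

(* None: no box; Some l: a box labeled l. *)
Definition diagram (n : nat) := {ffun 'I_n * 'I_n -> option label}.

Section Diagrams.
Variable n : nat.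
Implicit Types (D E : diagram n) (i j r : 'I_n) (w : 'S_n).

Definition boxes D : {set 'I_n * 'I_n} := [set b | D b != None].

Definition all_black (S : {set 'I_n * 'I_n}) : diagram n :=
  [ffun b => if b \in S then Some black else None].

Definition rothe w : {set 'I_n * 'I_n} :=
  [set b : 'I_n * 'I_n | (b.2 < w b.1)%N && (b.1 < (w^-1)%g b.2)%N].

Definition rightmost D i j : bool :=
  ((i, j) \in boxes D) && [forall c : 'I_n, (j < c)%N ==> ((i, c) \notin boxes D)].

Definition landing D i j i' : bool :=
  [&& (i' <= i)%N, (i', j) \notin boxes D
    & [forall r : 'I_n, (r <= i)%N && ((r, j) \notin boxes D) ==> (r <= i')%N]].

(* The common shape of the four moves: all boxes of column j in rows i'+1, ..., i
   carry the label l; a box labeled l is put at (i', j), and the content of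
   (i, j) becomes left. *)
Definition move (l : label) (left : option label) : rel (diagram n) :=
  fun D E => [exists i : 'I_n, exists j : 'I_n, exists i' : 'I_n,
    [&& rightmost D i j, landing D i j i',
        [forall r : 'I_n, (i' < r <= i)%N ==> (D (r, j) == Some l)]
      & E == [ffun b => if b == (i', j) then Some l
                        else if b == (i, j) then left else D b]]].

Definition kohnert : rel (diagram n) := move black None.
Definition k_kohnert : rel (diagram n) := move black (Some ghost).
Definition ghost_kohnert : rel (diagram n) := move ghost None.
Definition ghost_k_kohnert : rel (diagram n) := move ghost (Some ghost).

Definition KKoh (S : {set 'I_n * 'I_n}) : {set diagram n} :=
  [set E | connect (fun D D' => kohnert D D' || k_kohnert D D') (all_black S) E].

Definition tKKoh (S : {set 'I_n * 'I_n}) : {set diagram n} :=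
  [set E | connect (fun D D' => [|| kohnert D D', k_kohnert D D',
                                    ghost_kohnert D D' | ghost_k_kohnert D D'])
                   (all_black S) E].

Definition KKoh_wt w (gamma : 'X_{1..n}) : {set diagram n} :=
  [set D in KKoh (rothe w) | wt (boxes D) == gamma].

Definition tKKoh_wt w (gamma : 'X_{1..n}) : {set diagram n} :=
  [set D in tKKoh (rothe w) | wt (boxes D) == gamma].

(* (-1)^{#D - l(w)} x^{wt(D)}, with an integer exponent. *)
Definition signed_term w D : {mpoly int[n]} :=
  ((-1 : int) ^ (#|boxes D|%:Z - (coxlen w)%:Z)) *: 'X_[wt (boxes D)].

End Diagrams.

(* Main.v *)
Require Import Defs.
From mathcomp Require Import all_boot all_order all_fingroup all_algebra.
From mathcomp.multinomials Require Import mpoly.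
From mathcomp Require Import zify ring.

Set Implicit Arguments.
Unset Strict Implicit.
Unset Printing Implicit Defensive.

Import GRing.Theory.

(* All three families are parametrised by the same set-valued fillings [T] of the
   Rothe diagram: [T b] is the set of rows of the boxes that descend from the box
   [b], the topmost of them being black and the others ghosts; fillings are weakly
   decreasing along rows, strictly increasing down columns, and [T (i, j)] lies in
   rows at most [i].  Every (K-)Kohnert or ghost move preserves these conditions,
   because the Rothe diagram of a 321-avoiding permutation is a skew shape, and
   every filling is reached by moving boxes back down in a suitable order.

   In a word with Demazure product [w] each letter compares two values which are
   inverted in [w], i.e. a box of the Rothe diagram, and for 321-avoiding [w] this
   box determines the letter.  Recording the rows of the letters belonging to each
   box turns a pipe dream into a filling, and conversely.

   The pipe dream formula for the Grothendieck polynomial follows Fomin and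
   Kirillov: by the Yang-Baxter equation in the 0-Hecke algebra, the product of two
   consecutive rows and one more letter is symmetric in the two row variables,
   which is the divided difference recursion. *)

(** * Set-valued fillings of the Rothe diagram *)

(** Avoiding 321 means that no value is the smaller member of one inversion and the larger member of
    another. Along a word for [w], the displacement of a value therefore counts the partners it has
    already crossed, and two partners can become adjacent at one place only: this is why a box fixes
    its letter. A 0-Hecke word may compare the same two values several times, which is why fillings
    are set-valued. The generating function of pipe dreams is a coefficient of a product of factors
    [1 - x e_k]. Inverting such a factor costs a denominator [1 - x], so the symmetry of two rows is
    proved after multiplication by these scalars, which are then cancelled in an integral domain. *)

Ltac olia :=
  repeat match goal with H : ?P |- _ =>
    lazymatch P with
    | is_true (leq _ _) => fail | is_true (leq _ _ && leq _ _) => fail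
    | is_true (~~ leq _ _) => fail | is_true (~~ (leq _ _ && leq _ _)) => fail
    | not (@eq nat _ _) => fail
    | @eq nat _ _ => fail | @eq (ordinal _) _ _ => fail | _ => clear H end end;
  lia.

Section Rothe.
Variables (n : nat) (w : 'S_n).
Implicit Types (i j : 'I_n).

Lemma in_rothe i j : ((i, j) \in rothe w) = (j < w i) && (i < (w^-1)%g j).
Proof. by rewrite inE. Qed.

Hypothesis hw : avoids321 w.

Lemma rothe_NW i i' j j' : i' < i -> j < j' ->
  (i', j') \in rothe w -> (i, j) \in rothe w -> (i', j) \in rothe w.
Proof. by rewrite !in_rothe => ? ? /andP[? ?] /andP[? ?]; apply/andP; split; lia. Qed.

(** If [(i, j')] were missing, then [w i <= j'] or the value [j'] would stand at a position at most
    [i]. The values [w i'], then [w i] or [j'], then [j] would form a 321 pattern. *)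
Lemma rothe_SE i i' j j' : i' < i -> j < j' ->
  (i', j') \in rothe w -> (i, j) \in rothe w -> (i, j') \in rothe w.
Proof.
rewrite !in_rothe => ii jj /andP[h1 h2] /andP[h3 h4].
have wij : w i != j by apply/eqP => e; move: h3; rewrite e ltnn.
apply/andP; split.
  rewrite ltnNge; apply/negP => le; apply: hw.
  by exists i', i, ((w^-1)%g j); rewrite permKV; split => //; lia.
rewrite ltnNge; apply/negP => le.
have ne : (w^-1)%g j' != i.
  apply/eqP => e; apply: hw; exists i', i, ((w^-1)%g j).
  by rewrite permKV -e permKV; split => //; rewrite ?e //; lia.
apply: hw; exists i', ((w^-1)%g j'), ((w^-1)%g j); rewrite !permKV; split => //; try lia.
Qed.

End Rothe.

Definition filling (n : nat) := {ffun 'I_n * 'I_n -> {set 'I_n}}.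

Section Fillings.
Variables (n : nat) (w : 'S_n).
Implicit Types (i j r s : 'I_n) (b c : 'I_n * 'I_n) (T : filling n).

Definition svt T : bool :=
  [forall b, (T b != set0) == (b \in rothe w)] &&
  [forall b, forall c, forall r in T b, forall s in T c,
     [&& (b.1 == c.1) && (b.2 < c.2) ==> (s <= r),
         (b.2 == c.2) && (b.1 < c.1) ==> (r < s) & r <= b.1]].

Lemma svtP T : reflect
  [/\ forall b, (T b != set0) = (b \in rothe w),
      forall i j j' r s, r \in T (i, j) -> s \in T (i, j') -> j < j' -> s <= r,
      forall i i' j r s, r \in T (i, j) -> s \in T (i', j) -> i < i' -> r < s
    & forall i j r, r \in T (i, j) -> r <= i] (svt T).
Proof.
apply: (iffP andP) => [[/forallP h0 /forallP h]|[h0 h1 h2 h3]].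
  have H b c r s : r \in T b -> s \in T c -> [&& (b.1 == c.1) && (b.2 < c.2) ==> (s <= r),
         (b.2 == c.2) && (b.1 < c.1) ==> (r < s) & r <= b.1].
    move=> rb sc; have /forallP/(_ c)/forallP/(_ r)/implyP/(_ rb) := h b.
    by move/forallP/(_ s)/implyP/(_ sc).
  split=> [b|i j j' r s rT sT lt|i i' j r s rT sT lt|i j r rT]; first exact: (eqP (h0 b)).
  - by have /and3P[] := H _ _ _ _ rT sT; rewrite eqxx lt.
  - by have /and3P[] := H _ _ _ _ rT sT; rewrite eqxx lt.
  - by have /and3P[] := H _ _ _ _ rT rT.
split; first by apply/forallP => b; rewrite h0.
apply/forallP => -[i j]; apply/forallP => -[i' j'].
apply/forallP => r; apply/implyP => rT; apply/forallP => s; apply/implyP => sT.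
apply/and3P; split => /=; last exact: h3 rT.
  by apply/implyP => /andP[/eqP e lt]; subst i'; exact: h1 rT sT lt.
by apply/implyP => /andP[/eqP e lt]; subst j'; exact: h2 rT sT lt.
Qed.

(** Column strictness makes the sets of one column disjoint, so for a filling in [svt] the pick has
    at most one candidate. *)
Definition dg T : diagram n :=
  [ffun b : 'I_n * 'I_n =>
     if [pick i | b.1 \in T (i, b.2)] is Some i
     then Some [forall s in T (i, b.2), b.1 <= s] else None].

(** A relational description of the content of a box: through [dg_eq], equations between diagrams
    are checked box by box without evaluating the pick. *)
Definition dg_spec T r j (o : option label) : Prop :=
  if o is Some l then
    exists2 i, r \in T (i, j) & (is_true l <-> forall s, s \in T (i, j) -> r <= s)
  else forall i, r \notin T (i, j).

Lemma dg_specP T r j : dg_spec T r j (dg T (r, j)).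
Proof.
rewrite /dg ffunE /=; case: pickP => [i rT|h] /=; last by move=> i; rewrite h.
by exists i => //; split => /forall_inP.
Qed.

Lemma svt_row_uniq T r i i' j : svt T -> r \in T (i, j) -> r \in T (i', j) -> i = i'.
Proof.
move=> /svtP[_ _ hc _] h h'; apply: val_inj; case: (ltngtP i i') => // lt.
  by have := hc _ _ _ _ _ h h' lt; rewrite ltnn.
by have := hc _ _ _ _ _ h' h lt; rewrite ltnn.
Qed.

Lemma dg_eq T r j o : svt T -> dg_spec T r j o -> dg T (r, j) = o.
Proof.
move=> sT; have := dg_specP T r j; case: (dg T (r, j)) => [l|]; case: o => [l'|] //=.
- move=> [i ri h] [i' ri' h']; have e := svt_row_uniq sT ri ri'; subst i'.
  by congr Some; apply/idP/idP => [/h/h'|/h'/h].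
- by move=> [i ri h] /(_ i); rewrite ri.
- by move=> h [i' ri' _]; have := h i'; rewrite ri'.
Qed.

Lemma in_boxes_dg T r j : reflect (exists i, r \in T (i, j)) ((r, j) \in boxes (dg T)).
Proof.
rewrite inE; have := dg_specP T r j; case: (dg T (r, j)) => [l|] /= h; constructor.
  by case: h => i ? _; exists i.
by case=> i ri; have := h i; rewrite ri.
Qed.

Lemma svt_min T b : svt T -> b \in rothe w ->
  exists2 m, m \in T b & forall s, s \in T b -> m <= s.
Proof.
move=> /svtP[h0 _ _ _]; rewrite -h0 => /set0Pn[r rT].
by exists [arg min_(m < r in T b) m]; case: arg_minnP.
Qed.

Lemma svt_rothe T b r : svt T -> r \in T b -> b \in rothe w.
Proof. by move=> /svtP[h0 _ _ _] rT; rewrite -h0; apply/set0Pn; exists r. Qed.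

(* A ghost belongs to the nearest black box above it in its column, so the
   labels recover the blocks of a column from the top down. *)
Lemma dg_inj : {in svt &, injective dg}.
Proof.
move=> T T' sT sT' e.
have H (i j : 'I_n) : forall (A B : filling n), svt A -> svt B -> dg A = dg B ->
    (forall k : 'I_n, k < i -> A (k, j) = B (k, j)) -> A (i, j) \subset B (i, j).
  move=> A B sA sB eAB IH; apply/subsetP => r rA.
  have D := svt_rothe sA rA.
  have [m mA mmin] := svt_min sA D; have [m' mB mmin'] := svt_min sB D.
  have := sA => /svtP[_ _ cA _]; have := sB => /svtP[_ _ cB _].
  have /in_boxes_dg[k rB] : (r, j) \in boxes (dg B).
    by rewrite -eAB; apply/in_boxes_dg; exists i.
  case: (ltngtP k i) => [lt|lt|/val_inj <- //].
    by rewrite -IH // in rB; have := svt_row_uniq sA rA rB => ek; rewrite ek ltnn in lt.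
  (* Here [r] lies in a lower block [B (k, j)]. Its black top [s] must be the black top of
     [A (i, j)]; but the top [m'] of [B (i, j)] is a black box above [s], and no block of [A] is
     left for it. *)
  have [s sBk smin] := svt_min sB (svt_rothe sB rB).
  have : dg B (s, j) = Some true.
    by apply: dg_eq => //; exists k.
  rewrite -eAB => hs; have := dg_specP A s j; rewrite hs => -[x sx [/(_ isT) xmin _]].
  have sr : s <= r by apply: smin.
  case: (ltngtP x i) => [xi|xi|/val_inj ex].
  - rewrite (IH _ xi) in sx. 
    have ek := svt_row_uniq sB sBk sx. 
    rewrite ek in lt. 
    by clear -lt xi; olia.
  - by have := cA _ _ _ _ _ rA sx xi; olia.
  subst x.
  have : dg B (m', j) = Some true.
    by apply: dg_eq => //; exists i.
  rewrite -eAB => hm; have := dg_specP A m' j; rewrite hm => -[y my [/(_ isT) ymin _]].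
  have m's := cB _ _ _ _ _ mB sBk lt.
  case: (ltngtP y i) => [yi|yi|/val_inj ey].
  - by rewrite IH // in my; have ek := svt_row_uniq sB mB my; rewrite ek in yi; olia.
  - by have := cA _ _ _ _ _ sx my yi; olia.
  by subst y; have := xmin _ my; olia.
apply/ffunP => -[i j].
have [k] := ubnP (i : nat); elim: k i => // k IH i ik.
have IH' (x : 'I_n) : x < i -> T (x, j) = T' (x, j) by move=> ?; apply: IH; olia.
apply/eqP; rewrite eqEsubset; apply/andP; split; apply: H => //.
by move=> x xi; rewrite IH'.
Qed.

Definition svt0 : filling n := [ffun b : 'I_n * 'I_n => if b \in rothe w then [set b.1] else set0].

Lemma in_svt0 b r : (r \in svt0 b) = (b \in rothe w) && (r == b.1).
Proof. by rewrite ffunE; case: ifP; rewrite !inE. Qed.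

Lemma svt_svt0 : svt svt0.
Proof.
apply/svtP; split=> [b|i j j' r s|i i' j r s|i j r]; rewrite ?in_svt0.
- rewrite ffunE; case: ifP => _; last by rewrite eqxx.
  by apply/set0Pn; exists b.1; rewrite inE.
- by move=> /andP[_ /eqP->] /andP[_ /eqP->].
- by move=> /andP[_ /eqP->] /andP[_ /eqP->].
- by move=> /andP[_ /eqP->].
Qed.

Lemma dg_svt0 : dg svt0 = all_black (rothe w).
Proof.
apply/ffunP => -[r j]; apply: dg_eq; first exact: svt_svt0.
rewrite ffunE; case: ifP => h /=.
  exists r; first by rewrite in_svt0 h /=.
  by split => // _ s; rewrite in_svt0 => /andP[_ /eqP->].
by move=> i; rewrite in_svt0; apply/negP => /andP[h' /eqP /= e]; rewrite e h' in h.
Qed.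

End Fillings.

(** * Kohnert moves on fillings *)

Section Moves.
Variables (n : nat) (w : 'S_n).
Hypothesis hw : avoids321 w.
Implicit Types (i j r s t x c : 'I_n) (b : 'I_n * 'I_n) (T : filling n).

Definition ord_dec s : 'I_n := Ordinal (leq_ltn_trans (leq_pred s) (ltn_ord s)).

Lemma ord_succ_ex s r : s < r -> exists s1 : 'I_n, s1 = s.+1 :> nat.
Proof. by move=> sr; exists (Ordinal (leq_ltn_trans sr (ltn_ord r))). Qed.

(** * Black moves on fillings *)

Section BlackMove.
Variables (T : filling n) (K : bool) (r j r' : 'I_n).
Hypothesis sT : svt w T.
Hypothesis rT : exists x, r \in T (x, j).
Hypothesis right : forall c x, j < c -> r \notin T (x, c).
Hypothesis r'T : forall x, r' \notin T (x, j).
Hypothesis lt_r'r : r' < r.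
Hypothesis blk : forall s, r' < s <= r ->
  exists2 x, s \in T (x, j) & forall t, t \in T (x, j) -> s <= t.

(* A blocking box right of a jumped one would, by the skew shape of the Rothe
   diagram, force a box in row r right of column j. *)
Lemma black_free s x c : s \in T (x, j) -> r' < s <= r -> j < c -> s \notin T (x, c).
Proof.
have /svtP[h0 hr hc hf] := sT.
have [k] := ubnP (r - s); elim: k s x => // k IH s x rsk sx hs jc.
apply/negP => sc; case: (ltnP s r) => sr; last first.
  have e : s = r by apply: val_inj => /=; olia.
  by subst s; have := right x jc; rewrite sc.
have [s1 e1] := ord_succ_ex sr.
have hs1 : r' < s1 <= r by olia.
have [x1 s1x1 min1] := blk hs1.
have xx1 : x < x1.
  case: (ltngtP x x1) => // h.
    by have := hc _ _ _ _ _ s1x1 sx h; olia.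
  by move/val_inj in h; subst x1; have := min1 _ sx; olia.
have : (x1, c) \in rothe w.
  by apply: (rothe_SE hw xx1 jc); [apply: svt_rothe sT sc | apply: svt_rothe sT s1x1].
rewrite -h0 => /set0Pn[t tx1].
have l1 := hc _ _ _ _ _ sc tx1 xx1; have l2 := hr _ _ _ _ _ s1x1 tx1 jc.
have e : t = s1 by apply: val_inj => /=; olia.
subst t; have : s1 \notin T (x1, c) by apply: IH => //; olia.
by rewrite tx1.
Qed.

(** The diagram sends one box from row [r] to row [r'], but the filling shifts every box of rows
    [r'+1, ..., r] up by one: these boxes are tops of different blocks, whose order down the column
    must be kept. *)
Definition lift_row s : 'I_n := if r' < s <= r then ord_dec s else s.

Definition black_moved : filling n :=
  [ffun b : 'I_n * 'I_n => if b.2 == j then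
     lift_row @: T b :|: (if K && (r \in T b) then [set r] else set0) else T b].

Lemma black_moved_neq x c : c != j -> black_moved (x, c) = T (x, c).
Proof. by rewrite ffunE /= => /negPf->. Qed.

Lemma black_movedP x t : t \in black_moved (x, j) -> exists2 s, s \in T (x, j) &
  (r' < s <= r /\ t.+1 = s) \/ (K /\ s = r /\ t = r) \/ (~~ (r' < s <= r) /\ t = s).
Proof.
rewrite ffunE /= eqxx inE => /orP[/imsetP[s sx ->]|].
  exists s => //; rewrite /lift_row; case: ifP => h; [left|right;right] => //.
  by split=> //=; olia.
case: K => /=; last by rewrite inE.
case: ifP => [rx|_]; rewrite inE // => /eqP->; exists r => //; by right; left.
Qed.

Lemma black_moved_mem x s : s \in T (x, j) -> lift_row s \in black_moved (x, j).
Proof. by move=> sx; rewrite ffunE /= eqxx inE imset_f. Qed.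

(** Lifting by one row keeps the row condition because no box of the same row lies further right
    ([black_free]), and column strictness because row [r'] was empty. *)
Lemma black_moved_svt : svt w black_moved.
Proof.
have /svtP[h0 hr hc hf] := sT.
have ne s x : s \in T (x, j) -> (s : nat) <> r'.
  by move=> sx /val_inj e; have := r'T x; rewrite -e sx.
apply/svtP; split=> [[x c]|x c c' t t'|x x' c t t'|x c t].
- rewrite -h0; case: (eqVneq c j) => [->|cj]; last by rewrite black_moved_neq.
  apply/set0Pn/set0Pn => [[t /black_movedP[s sx _]]|[s sx]]; first by exists s.
  by exists (lift_row s); apply: black_moved_mem.
- case: (eqVneq c j) => [->|cj]; case: (eqVneq c' j) => [->|cj'].
  + by rewrite ltnn.
  + rewrite (black_moved_neq _ cj') => /black_movedP[s sx h] t'x jc.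
    have l := hr _ _ _ _ _ sx t'x jc.
    case: h => [[hs e]|[[_ [e1 e2]]|[_ e]]].
    * have := black_free sx hs jc.
      have : (t' : nat) <> s \/ t' = s by case: (eqVneq t' s) => [->|?]; [right|left=> /val_inj/eqP; apply/negP].
      by case=> [?|e']; [olia | rewrite -e' t'x].
    * by subst; olia.
    * by subst; olia.
  + rewrite (black_moved_neq _ cj) => tx /black_movedP[s sx h] jc.
    have l := hr _ _ _ _ _ tx sx jc.
    by case: h => [[hs e]|[[_ [e1 e2]]|[_ e]]]; subst; olia.
  + by rewrite (black_moved_neq _ cj) (black_moved_neq _ cj'); apply: hr.
- case: (eqVneq c j) => [->|cj]; last by rewrite !(black_moved_neq _ cj); apply: hc.
  move=> /black_movedP[s sx h] /black_movedP[s' sx' h'] xx.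
  have l := hc _ _ _ _ _ sx sx' xx; have n1 := ne _ _ sx; have n2 := ne _ _ sx'.
  by case: h => [[hs e]|[[_ [e1 e2]]|[hs e]]]; case: h' => [[hs' e']|[[_ [e1' e2']]|[hs' e']]];
     subst; olia.
- case: (eqVneq c j) => [->|cj]; last by rewrite !(black_moved_neq _ cj); apply: hf.
  move=> /black_movedP[s sx h]; have := hf _ _ _ sx.
  by case: h => [[hs e]|[[_ [e1 e2]]|[_ e]]]; subst; olia.
Qed.

Lemma black_moved_dg : dg black_moved =
  [ffun b => if b == (r', j) then Some black
             else if b == (r, j) then (if K then Some ghost else None) else dg T b].
Proof.
have svt' := black_moved_svt.
apply/ffunP => -[t c]; apply: (dg_eq svt'); rewrite ffunE !xpair_eqE.
case: (eqVneq c j) => [->|cj]; last first.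
  rewrite !andbF; have := dg_specP T t c; case: (dg T (t, c)) => [l|] /= h.
    by case: h => x tx h; exists x; rewrite black_moved_neq.
  by move=> x; rewrite black_moved_neq.
rewrite !andbT.
(* The shifted tops fill rows [r', ..., r-1] with black boxes, so the net change of the diagram is
   confined to rows [r'] and [r]. *)
have mid t0 : r' <= t0 < r -> dg_spec black_moved t0 j (Some true).
  move=> ht; have [|s1 e1] := @ord_succ_ex t0 r; first by olia.
  have hs1 : r' < s1 <= r by olia.
  have [x sx smin] := blk hs1; exists x.
    have -> : t0 = lift_row s1 by apply: val_inj; rewrite /lift_row hs1 /= e1.
    exact: black_moved_mem.
  split=> // _ s /black_movedP[s' /smin l [[? ?]|[[_ [? ?]]|[_ ?]]]]; subst; olia.
case: (eqVneq t r') => [e|tr']; first by apply: mid; rewrite e leqnn lt_r'r.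
case: (eqVneq t r) => [e|tr].
  subst t; have [x rx] := rT; case E : K.
    exists x; first by rewrite ffunE /= eqxx E rx !inE eqxx orbT.
    split=> // /(_ (lift_row r) (black_moved_mem rx)).
    by rewrite /lift_row lt_r'r leqnn /=; olia.
  move=> y; apply/negP => /black_movedP[s sx [[? ?]|[[h _]|[/negP h e]]]].
  - by olia.
  - by rewrite E in h.
  - by apply: h; rewrite -e lt_r'r leqnn.
have tr'n : (t : nat) != r' by []. have trn : (t : nat) != r by [].
case: (boolP (r' < t < r)) => ht.
  have ht' : r' < t <= r by move: ht; clear; lia.
  have [x tx tmin] := blk ht'.
  have -> : dg T (t, j) = Some true by apply: (dg_eq sT); exists x.
  by apply: mid; move: ht; clear; lia.
have := dg_specP T t j; case: (dg T (t, j)) => [l|] /= h.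
  case: h => x tx h; exists x.
    suff <- : lift_row t = t by apply: black_moved_mem.
    by rewrite /lift_row; case: ifP => // h1; exfalso; move: ht trn h1; clear; lia.
  split=> [/h {}h s /black_movedP[s' /h l' [[e1 e2]|[[_ [? ?]]|[_ ?]]]]|h2].
  - by move: ht tr'n trn; clear -l' e1 e2; lia.
  - by subst; move: l'.
  - by subst.
  apply/h => s sx; have := h2 _ (black_moved_mem sx); rewrite /lift_row.
  by case: ifP => //= _; clear; lia.
move=> x; apply/negP => /black_movedP[s sx [[h1 e]|[[_ [? e]]|[_ e]]]].
- by move: ht tr'n trn; clear -h1 e; lia.
- by subst; rewrite eqxx in tr.
- by subst; have := h x; rewrite sx.
Qed.

End BlackMove.

(** * Ghost moves on fillings *)

Section GhostMove.
Variables (T : filling n) (K : bool) (r j r' a : 'I_n).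
Hypothesis sT : svt w T.
Hypothesis rT : r \in T (a, j).
Hypothesis r'T : forall x, r' \notin T (x, j).
Hypothesis lt_r'r : r' < r.
Hypothesis gho : forall s, r' < s <= r ->
  exists2 x, s \in T (x, j) & exists2 t, t \in T (x, j) & t < s.

(** A block begins with a black box, so consecutive ghosts of a column belong to the same block. *)
Lemma ghost_same s : r' < s <= r -> s \in T (a, j).
Proof.
have /svtP[h0 hr hc hf] := sT.
have [k] := ubnP (r - s); elim: k s => // k IH s rsk hs.
case: (ltnP s r) => sr; last first.
  by have -> : s = r by apply: val_inj => /=; olia.
have [s1 e1] := ord_succ_ex sr.
have hs1 : r' < s1 <= r by olia.
have s1a : s1 \in T (a, j) by apply: IH => //; olia.
have [x s1x [t tx ts1]] := gho hs1; have e := svt_row_uniq sT s1x s1a; subst x.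
have [y sy _] := gho hs; case: (ltngtP y a) => [ya|ya|/val_inj <- //].
  by have := hc _ _ _ _ _ sy tx ya; olia.
by have := hc _ _ _ _ _ s1a sy ya; olia.
Qed.

(** Row [r'] thus lies strictly inside the block of [a], between [m] and [r], so inserting it
    disturbs neither the inequalities nor the black top. Unlike a black move, a ghost move changes a
    single block. *)
Lemma ghost_above : exists2 m, m \in T (a, j) & m < r'.
Proof.
have [s1 e1] := ord_succ_ex lt_r'r.
have hs1 : r' < s1 <= r by olia.
have [x s1x [t tx ts1]] := gho hs1.
have e := svt_row_uniq sT s1x (ghost_same hs1); subst x.
exists t => //; rewrite ltn_neqAle; apply/andP; split; last by olia.
by apply/eqP => /val_inj e; have := r'T a; rewrite -e tx.
Qed.

Definition ghost_moved : filling n :=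
  [ffun b => if b == (a, j) then r' |: (if K then T b else T b :\ r) else T b].

Lemma in_ghost_moved x c t : (t \in ghost_moved (x, c)) =
  if (x, c) == (a, j) then (t == r') || (K || (t != r)) && (t \in T (x, c)) else t \in T (x, c).
Proof. by rewrite ffunE; case: ifP => //; case: K; rewrite !inE. Qed.

Lemma ghost_moved_svt : svt w ghost_moved.
Proof.
have /svtP[h0 hr hc hf] := sT; have [m ma mr'] := ghost_above.
have mem x c t : t \in ghost_moved (x, c) ->
    t \in T (x, c) \/ [/\ x = a, c = j & t = r'].
  rewrite in_ghost_moved; case: eqP => [[-> ->]|_]; last by left.
  by case/orP => [/eqP->|/andP[_ ?]]; [right | left].
apply/svtP; split=> [[x c]|x c c' t t'|x x' c t t'|x c t].
- rewrite -h0 ffunE; case: ((x, c) =P (a, j)) => // -[-> ->]; apply/set0Pn/set0Pn => _.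
    by exists r.
  by exists r'; rewrite !inE eqxx.
- move=> /mem[tx|[? ? ?]] /mem[tx'|[? ? ?]] cc; subst.
  + exact: hr tx tx' cc.
  + by have := hr _ _ _ _ _ tx rT cc; olia.
  + by have := hr _ _ _ _ _ ma tx' cc; olia.
  + by rewrite ltnn in cc.
- move=> /mem[tx|[? ? ?]] /mem[tx'|[? ? ?]] cc; subst.
  + exact: hc tx tx' cc.
  + by have := hc _ _ _ _ _ tx ma cc; olia.
  + by have := hc _ _ _ _ _ rT tx' cc; olia.
  + by rewrite ltnn in cc.
- move=> /mem[tx|[? ? ?]]; first exact: hf tx.
  by subst; have := hf _ _ _ rT; olia.
Qed.

Lemma ghost_moved_dg : dg ghost_moved =
  [ffun b => if b == (r', j) then Some ghost
             else if b == (r, j) then (if K then Some ghost else None) else dg T b].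
Proof.
have svt' := ghost_moved_svt; have [m ma mr'] := ghost_above.
have m' : m \in ghost_moved (a, j).
  rewrite in_ghost_moved eqxx ma andbT; case: (eqVneq m r) => [e|]; last by rewrite !orbT.
  by exfalso; subst; olia.
apply/ffunP => -[t c]; apply: (dg_eq svt'); rewrite ffunE.
case: eqP => [[-> ->]|n1].
  exists a; first by rewrite in_ghost_moved !eqxx.
  by split=> // /(_ _ m'); olia.
case: eqP => [[-> ->]|n2].
  case E : K.
    exists a; first by rewrite in_ghost_moved eqxx E rT orbT.
    by split=> // /(_ _ m'); olia.
  move=> x; rewrite in_ghost_moved; case: eqP => [|ne].
    by rewrite E eqxx /= orbF => -[ex]; apply/eqP => e; have := lt_r'r; rewrite e ltnn.
  by apply/negP => rx; apply: ne; rewrite (svt_row_uniq sT rx rT).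
have := dg_specP T t c; case: (dg T (t, c)) => [l|] /= h.
  case: h => x tx h; exists x.
    rewrite in_ghost_moved tx; case: eqP => // -[ex ec]; subst.
    by case: (eqVneq t r) => [e|]; [subst | rewrite !orbT].
  rewrite h; split => {}h s.
    rewrite in_ghost_moved; case: eqP => [[ex ec]|_]; last exact: h.
    subst; case/orP => [/eqP->|/andP[_ ?]]; last exact: h.
    by have := h _ ma; olia.
  move=> sx; have := h s; rewrite in_ghost_moved sx andbT.
  case: eqP => [[ex ec]|_]; last exact.
  subst; case: (eqVneq s r) => [->|_]; last by rewrite !orbT; apply.
  by move=> _; have := h _ m'; olia.
move=> x; rewrite in_ghost_moved; case: eqP => [[ex ec]|_]; last exact: h.
subst; rewrite (negPf (h a)) andbF orbF.
by apply/eqP => e; subst.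
Qed.

End GhostMove.

Lemma move_svt l (K : bool) T E : svt w T ->
  move l (if K then Some ghost else None) (dg T) E -> exists2 T', svt w T' & E = dg T'.
Proof.
move=> sT /existsP[r /existsP[j /existsP[r' /and4P[rm la lab /eqP->]]]].
have /andP[/in_boxes_dg[a ra] /forallP rm'] := rm.
have /and3P[r'r /in_boxes_dg r'T _] := la.
have {}r'T x : r' \notin T (x, j) by apply/negP => ?; apply: r'T; exists x.
have lt : r' < r.
  rewrite ltn_neqAle r'r andbT; apply/eqP => /val_inj e.
  by have := r'T a; rewrite e ra.
have {}lab s : r' < s <= r -> dg T (s, j) = Some l.
  by move=> hs; have /forallP/(_ s)/implyP/(_ hs)/eqP := lab.
case: l lab => lab.
  have right c x : j < c -> r \notin T (x, c).
    move=> jc; have /implyP/(_ jc) := rm' c.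
    by apply: contra => rx; apply/in_boxes_dg; exists x.
  have blk s : r' < s <= r -> exists2 x, s \in T (x, j) & forall t, t \in T (x, j) -> s <= t.
    move=> /lab e; have := dg_specP T s j; rewrite e => -[x sx [/(_ isT) h _]].
    by exists x.
  exists (black_moved T K r j r'); first exact: black_moved_svt.
  by rewrite black_moved_dg //; exists a.
have gho s : r' < s <= r ->
    exists2 x, s \in T (x, j) & exists2 t, t \in T (x, j) & t < s.
  move=> /lab e; have := dg_specP T s j; rewrite e => -[x sx [_ h]]; exists x => //.
  apply/exists_inP; apply: contraT; rewrite negb_exists_in => /forall_inP h'.
  by apply: h => t /h'; rewrite -leqNgt.
exists (ghost_moved T K r j r' a); first exact: ghost_moved_svt.
by rewrite ghost_moved_dg.
Qed.

Lemma connect_svt (e : rel (diagram n)) : (forall T E, svt w T -> e (dg T) E ->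
    exists2 T', svt w T' & E = dg T') ->
  forall E, connect e (all_black (rothe w)) E -> exists2 T, svt w T & E = dg T.
Proof.
move=> he E /connectP[p]; rewrite -dg_svt0.
elim: p (svt0 w) (svt_svt0 w) => [|D p IH] T sT /=; first by move=> _ ->; exists T.
by move=> /andP[/(he _ _ sT)[T' sT' ->]]; apply: IH.
Qed.

Lemma tKKoh_svt E : E \in tKKoh (rothe w) -> exists2 T, svt w T & E = dg T.
Proof.
rewrite inE; apply: connect_svt => T {}E sT /or4P[] h.
- exact: (@move_svt black false T E sT h).
- exact: (@move_svt black true T E sT h).
- exact: (@move_svt ghost false T E sT h).
- exact: (@move_svt ghost true T E sT h).
Qed.

Lemma KKoh_sub_tKKoh (S : {set 'I_n * 'I_n}) : KKoh S \subset tKKoh S.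
Proof.
apply/subsetP => E; rewrite !inE; apply: (@connect_sub _ _ _ _ (all_black S) E) => D D' h.
by apply: connect1; case/orP: h => ->; rewrite ?orbT.
Qed.

Lemma svt_flag_min T i j m : svt w T -> m \in T (i, j) ->
  (forall s, s \in T (i, j) -> m <= s) -> (T (i, j) != [set i]) = (m < i).
Proof.
move=> sT mT mmin; have /svtP[_ _ _ hf] := sT; have mi := hf _ _ _ mT.
apply/idP/idP => [|lt]; last first.
  by apply/eqP => e; move: mT; rewrite e inE => /eqP e'; rewrite e' ltnn in lt.
apply: contraR; rewrite -leqNgt => im.
have e : m = i by apply: val_inj => /=; olia.
subst m; rewrite eqEsubset sub1set mT andbT; apply/subsetP => s sT'.
by rewrite inE; apply/eqP/val_inj => /=; have := mmin _ sT'; have := hf _ _ _ sT'; olia.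
Qed.

(** * Moving a box back down *)

Section Unmove.
Variables (T : filling n) (a j m m1 : 'I_n).
Hypothesis sT : svt w T.
Hypothesis mT : m \in T (a, j).
Hypothesis mmin : forall s, s \in T (a, j) -> m <= s.
Hypothesis lt_ma : m < a.
Hypothesis m1E : m1 = m.+1 :> nat.
Hypothesis below : forall i c, a < i -> (i, c) \in rothe w -> T (i, c) = [set i].
Hypothesis left : forall c, c < j -> (a, c) \in rothe w -> T (a, c) = [set a].

(** If [m1] is already a ghost of the block, it absorbs the lowered top and a K-Kohnert move is
    undone; otherwise a Kohnert move is undone. *)
Definition unmoved : filling n :=
  [ffun b => if b == (a, j) then m1 |: (T b :\ m) else T b].

Lemma unmovedP x c t : t \in unmoved (x, c) -> (t \in T (x, c) /\ (x, c, t) <> (a, j, m))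
  \/ [/\ x = a, c = j & t = m1].
Proof.
rewrite ffunE; case: eqP => [[-> ->]|ne]; last by left; split => // -[? ? ?]; subst.
rewrite !inE => /orP[/eqP->|/andP[tm tx]]; first by right.
by left; split => // -[e]; rewrite e eqxx in tm.
Qed.

Lemma in_unmoved x c t : (x, c, t) <> (a, j, m) -> t \in T (x, c) -> t \in unmoved (x, c).
Proof.
rewrite ffunE; case: eqP => [[-> ->]|//] ne tx; rewrite !inE tx andbT.
by case: (eqVneq t m) => [e|_]; [subst | rewrite orbT].
Qed.

Lemma m1_unmoved : m1 \in unmoved (a, j).
Proof. by rewrite ffunE eqxx !inE eqxx. Qed.

Lemma unmoved_svt : svt w unmoved.
Proof.
have /svtP[h0 hr hc hf] := sT.
apply/svtP; split=> [[x c]|x c c' t t'|x x' c t t'|x c t].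
- rewrite -h0; case: (eqVneq (x, c) (a, j)) => [[-> ->]|ne].
    have -> : T (a, j) != set0 by apply/set0Pn; exists m.
    by apply/set0Pn; exists m1; apply: m1_unmoved.
  by rewrite ffunE (negPf ne).
- move=> /unmovedP[[tx n1]|[? ? ?]] /unmovedP[[tx' n2]|[? ? ?]] cc; subst.
  + exact: hr tx tx' cc.
  + have := left cc (svt_rothe sT tx) => e; rewrite e inE in tx; move/eqP in tx; subst t.
    by olia.
  + by have := hr _ _ _ _ _ mT tx' cc; olia.
  + by rewrite ltnn in cc.
- move=> /unmovedP[[tx n1]|[? ? ?]] /unmovedP[[tx' n2]|[? ? ?]] cc; subst.
  + exact: hc tx tx' cc.
  + by have := hc _ _ _ _ _ tx mT cc; olia.
  + have e := below cc (svt_rothe sT tx'); rewrite e inE in tx'; move/eqP in tx'; subst t'.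
    by olia.
  + by rewrite ltnn in cc.
- move=> /unmovedP[[tx n1]|[? ? ?]]; first exact: hf tx.
  by subst; olia.
Qed.

Lemma unmoved_col x : m1 \in T (x, j) -> x = a.
Proof.
move=> h; have /svtP[h0 hr hc hf] := sT; apply: val_inj; case: (ltngtP x a) => // lt.
  by have := hc _ _ _ _ _ h mT lt; olia.
by have e := below lt (svt_rothe sT h); rewrite e inE in h; move/eqP in h; move: m1E; rewrite h; olia.
Qed.

(** A move requires the lowered box to be rightmost in its row. A box of row [m1] further right
    cannot come from below row [a], where nothing is displaced. If it came from above, the skew
    shape would give a box [(x, j)] whose rows are at least [m1] and yet less than [m]. *)
Lemma unmoved_right x c : j < c -> m1 \notin T (x, c).
Proof.
move=> jc; have /svtP[h0 hr hc hf] := sT; apply/negP => h.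
have xc := svt_rothe sT h; have aj := svt_rothe sT mT.
case: (ltngtP x a) => [lt|lt|/val_inj e].
- have := rothe_NW lt jc xc aj; rewrite -h0 => /set0Pn[t tx].
  by have := hr _ _ _ _ _ tx h jc; have := hc _ _ _ _ _ tx mT lt; olia.
- by rewrite (below lt xc) inE in h; move/eqP in h; move: m1E; rewrite h; olia.
- by subst; have := hr _ _ _ _ _ mT h jc; olia.
Qed.

Lemma unmoved_move :
  move black (if m1 \in T (a, j) then Some ghost else None) (dg unmoved) (dg T).
Proof.
have svt' := unmoved_svt.
have m1u : m1 \in unmoved (a, j) := m1_unmoved.
have mu x : m \notin unmoved (x, j).
  apply/negP => /unmovedP[[h ne]|[_ _ e]]; last by have := m1E; rewrite -e; olia.
  by apply: ne; rewrite (svt_row_uniq sT h mT).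
apply/existsP; exists m1; apply/existsP; exists j; apply/existsP; exists m; apply/and4P; split.
- apply/andP; split; first by apply/in_boxes_dg; exists a.
  apply/forallP => c; apply/implyP => jc; apply/in_boxes_dg => -[x].
  move=> /unmovedP[[h _]|[_ e _]]; last by subst; rewrite ltnn in jc.
  by have := unmoved_right x jc; rewrite h.
- apply/and3P; split; first by olia.
    by apply/in_boxes_dg => -[x h]; have := mu x; rewrite h.
  apply/forallP => t; apply/implyP => /andP[tm1 tb].
  have ne : (t : nat) <> m1.
    by move=> /val_inj e; move/negP: tb; apply; apply/in_boxes_dg; exists a; rewrite e.
  by olia.
- apply/forallP => t; apply/implyP => tm.
  have -> : t = m1 by apply: val_inj => /=; olia.
  apply/eqP/(dg_eq svt'); exists a => //; split => // _ s /unmovedP[[h ne]|[_ _ ->]] //.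
  have : (s : nat) <> m by move=> /val_inj e; apply: ne; rewrite e.
  by have := mmin h; olia.
- apply/eqP/ffunP => -[t c]; apply: (dg_eq sT); rewrite ffunE.
  case: eqP => [[-> ->]|n1]; first by exists a.
  case: eqP => [[-> ->]|n2].
    case: ifP => h; last by move=> x; apply/negP => hx; rewrite -(unmoved_col hx) hx in h.
    by exists a => //; split => // /(_ _ mT); olia.
  have tne x : t \in T (x, c) -> t \in unmoved (x, c).
    by apply: in_unmoved => -[? ? ?]; subst.
  have := dg_specP unmoved t c; case: (dg unmoved (t, c)) => [l|] /= h; last first.
    by move=> x; apply/negP => /tne hx; have := h x; rewrite hx.
  case: h => x tx hl; exists x; first by case/unmovedP: tx => [[]|[? ? ?]] //; subst.
  rewrite hl; split=> h s.
    move=> sx; case: (eqVneq (x, c, s) (a, j, m)) => [[? ? ?]|ne]; last first.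
      by apply: h; apply: in_unmoved => //; apply/eqP.
    subst; have := h _ m1u; have : (t : nat) <> m1 by move=> /val_inj ?; subst.
    by olia.
  move=> /unmovedP[[sx ne]|[? ? ?]]; first exact: h.
  by subst; have := h _ mT; olia.
Qed.

End Unmove.

(* In the lowest row that differs from the Rothe diagram, the leftmost displaced
   box can be moved back down by one row. *)
Lemma svt_KKoh T : svt w T -> dg T \in KKoh (rothe w).
Proof.
(* [mu] adds up how far the tops of the blocks have risen; the inner sum has one term, at the
   minimum of [U b], and avoids choosing that minimum. *)
pose mu (U : filling n) := \sum_(b in rothe w) \sum_(s in U b | [forall t in U b, s <= t]) (b.1 - s).
have muE (U : filling n) b m : m \in U b -> (forall s, s \in U b -> m <= s) ->
    \sum_(s in U b | [forall t in U b, s <= t]) (b.1 - s) = b.1 - m.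
  move=> mU mmin; rewrite (big_pred1 m) // => s; apply/andP/eqP => [[sU /forall_inP h]|->].
    by apply: val_inj => /=; have := h _ mU; have := mmin _ sU; clear; lia.
  by split=> //; apply/forall_inP.
have [k] := ubnP (mu T); elim: k T => // k IH T muk sT.
have /svtP[h0 hr hc hf] := sT.
pose bad b := (b \in rothe w) && (T b != [set b.1]).
case: (pickP bad) => [[i0 j00] bad0|good]; last first.
  suff -> : T = svt0 w by rewrite dg_svt0 inE connect0.
  apply/ffunP => b; rewrite ffunE; have := good b; rewrite /bad.
  case: ifP => [_ /negbFE/eqP //|bw _]; apply/eqP.
  by apply: contraFT bw => h; rewrite -h0.
pose a := [arg max_(i > i0 | [exists j, bad (i, j)]) (i : nat)].
have [a_ex amax] : [exists j, bad (a, j)] /\ forall i, [exists j, bad (i, j)] -> i <= a.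
  rewrite /a; by case: arg_maxnP => //; apply/existsP; exists j00.
have /existsP[j0 badj0] := a_ex.
pose j := [arg min_(j < j0 | bad (a, j)) (j : nat)].
have [/andP[aj nt] jmin] : bad (a, j) /\ forall c, bad (a, c) -> j <= c.
  by rewrite /j; case: arg_minnP.
have [m mT mmin] := svt_min sT aj.
have lt_ma : m < a by rewrite -(svt_flag_min sT mT mmin).
have [m1 m1E] := ord_succ_ex lt_ma.
have below i c : a < i -> (i, c) \in rothe w -> T (i, c) = [set i].
  move=> ai ic; apply/eqP; apply: contraLR ai => h; rewrite -leqNgt.
  by apply: amax; apply/existsP; exists c; apply/andP.
have left c : c < j -> (a, c) \in rothe w -> T (a, c) = [set a].
  move=> cj ac; apply/eqP; apply: contraLR cj => h; rewrite -leqNgt.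
  by apply: jmin; apply/andP.
have svt' := unmoved_svt sT mT lt_ma m1E below left.
have mv := unmoved_move sT mT mmin lt_ma m1E below left.
have : dg (unmoved T a j m m1) \in KKoh (rothe w).
  apply: IH => //; suff lt : mu (unmoved T a j m m1) < mu T by move: muk lt; clear; lia.
  rewrite /mu.
  rewrite (bigD1 (a, j)) //= [X in _ < X](bigD1 (a, j)) //=.
  rewrite (muE _ _ _ mT mmin) (muE _ _ m1); first last.
  - move=> s /unmovedP[[h ne]|[_ _ ->]] //.
    have : (s : nat) <> m by move=> /val_inj e; apply: ne; rewrite e.
    by have := mmin _ h; olia.
  - exact: m1_unmoved.
  rewrite -addSn leq_add //=; first by olia.
  rewrite leq_eqVlt; apply/orP; left; apply/eqP; apply: eq_bigr => b /andP[_ ne].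
  by rewrite ffunE (negPf ne).
rewrite !inE => /connect_trans; apply; apply: connect1.
by rewrite /kohnert /k_kohnert; case: ifP mv => _ ->; rewrite ?orbT.
Qed.

Lemma KKohE : KKoh (rothe w) = [set dg T | T in [set T | svt w T]].
Proof.
apply/setP => E; apply/idP/imsetP => [|[T]]; last by rewrite inE => ? ->; apply: svt_KKoh.
by move=> /(subsetP (KKoh_sub_tKKoh _))/tKKoh_svt[T ? ->]; exists T; rewrite ?inE.
Qed.

(** The way back down to the Rothe diagram undoes only Kohnert and K-Kohnert moves, so the ghost
    moves reach nothing new. *)
Lemma tKKohE : tKKoh (rothe w) = KKoh (rothe w).
Proof.
apply/eqP; rewrite eqEsubset KKoh_sub_tKKoh andbT.
by apply/subsetP => E /tKKoh_svt[T ? ->]; apply: svt_KKoh.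
Qed.

End Moves.

(** * Crossings of 0-Hecke words *)

Section HeckeWords.
Variable m : nat.
Implicit Types (u W : 'S_m) (l : 'I_m.-1) (x y z v : 'I_m) (b c : 'I_m * 'I_m)
  (s : seq 'I_m.-1) (t : seq ('I_m * 'I_m)).

Lemma hecke_mulE u l :
  hecke_mul u l = if u (sleft l) < u (sright l) then rmul_simple u l else u.
Proof.
rewrite /hecke_mul !coxlenE; case: (asc_or_desc u l) => h.
  by rewrite (ninv_asc h) ltnSn h.
by rewrite (ninv_desc h) ltnNge leqnSn /= ltnNge (ltnW h).
Qed.

Lemma rmul_simpleV u l x : ((rmul_simple u l)^-1 x = simple l (u^-1 x))%g.
Proof. by rewrite /rmul_simple invMg permM /simple tpermV. Qed.

(* Inversions recorded by values: y > v, and y stands to the left of v. *)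
Definition vinv u y v : bool := (v < y) && ((u^-1)%g y < (u^-1)%g v).

(** The two values compared by the letter [l], larger first. After the letter they form an
    inversion, whether or not they did before. *)
Definition cross u l : 'I_m * 'I_m :=
  if u (sleft l) < u (sright l) then (u (sright l), u (sleft l))
  else (u (sleft l), u (sright l)).

Lemma hecke_crossE u l :
  hecke_mul u l (sleft l) = (cross u l).1 /\ hecke_mul u l (sright l) = (cross u l).2.
Proof.
rewrite hecke_mulE /cross; case: ifP => _ //=.
by rewrite !rmul_simpleE /simple tpermL tpermR.
Qed.

Lemma cross_pos u l : ((hecke_mul u l)^-1)%g (cross u l).1 = sleft l /\
  ((hecke_mul u l)^-1)%g (cross u l).2 = sright l.
Proof. by have [<- <-] := hecke_crossE u l; rewrite !permK. Qed.

(** Inversions only accumulate along a word, so those of a Demazure product are the pairs that were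
    ever compared. *)
Lemma vinv_hecke u l y v :
  vinv (hecke_mul u l) y v = vinv u y v || ((y, v) == cross u l).
Proof.
rewrite /vinv hecke_mulE /cross.
set p := (u^-1)%g y; set q := (u^-1)%g v.
have -> : y = u p by rewrite permKV.
have -> : v = u q by rewrite permKV.
case: (asc_or_desc u l) => h; last first.
  rewrite [u (sleft l) < _]ltnNge (ltnW h) /= !permK xpair_eqE.
  case: eqP => [/perm_inj ->|_]; last by rewrite orbF.
  by case: eqP => [/perm_inj ->|_]; rewrite ?orbF //= h /=; lia.
rewrite h !rmul_simpleV !permK /= xpair_eqE.
rewrite ![u _ == _](inj_eq perm_inj) /simple.
have := sleft_neq_sright l.
case: (tpermP (sleft l) (sright l) p) => [->|->|/eqP p1 /eqP p2];
case: (tpermP (sleft l) (sright l) q) => [->|->|/eqP q1 /eqP q2];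
  rewrite ?eqxx ?(negPf p1) ?(negPf p2) ?(negPf q1) ?(negPf q2) ?andbF ?orbF ?ltnn ?andbF //=;
  try (move=> ne; rewrite ?(negPf ne) ?[sright l == _]eq_sym ?(negPf ne) ?andbF ?orbF).
all: try (by move: h; lia).
all: congr (_ && _).
all: repeat match goal with H : is_true (_ != _) |- _ => move: H end.
all: rewrite -!val_eqE /=; lia.
Qed.

Lemma card_ord_lt x : #|[set z : 'I_m | z < x]| = x.
Proof.
have inj : injective (widen_ord (ltnW (ltn_ord x))).
  by move=> k k' /(congr1 val) /= e; apply: val_inj.
rewrite -[RHS](card_ord x) -cardsT -(card_imset _ inj).
congr #|pred_of_set _|; apply/setP => z; rewrite inE; apply/idP/imsetP => [zx|[k _ ->]]; last exact: ltn_ord k.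
by exists (Ordinal zx); [rewrite inE | apply: val_inj].
Qed.

(** Compare the values standing left of [v] with the values less than [v]: the two set differences
    are the two sets of inversions. *)
Lemma posE u v : (u^-1)%g v + #|[set x | vinv u v x]| = v + #|[set y | vinv u y v]|.
Proof.
pose A := [set x : 'I_m | (u^-1)%g x < (u^-1)%g v]; pose S := [set x : 'I_m | x < v].
have cA : #|A| = (u^-1)%g v.
  rewrite -[RHS](card_ord_lt ((u^-1)%g v)) -[RHS](card_preimset _ (@perm_inj _ (u^-1)%g)).
  by apply: eq_card => x; rewrite !inE.
have := cardsID S A; have := cardsID A S; rewrite cA (card_ord_lt v) setIC => e1 e2.
have -> : [set x | vinv u v x] = S :\: A.
  apply/setP => x; rewrite !inE /vinv andbC; case: (ltnP x v) => xv; rewrite ?andbF //.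
  rewrite !andbT -leqNgt [RHS]leq_eqVlt; case: eqP => // /ord_inj/perm_inj e.
  by rewrite e ltnn in xv.
have -> : [set y | vinv u y v] = A :\: S.
  apply/setP => x; rewrite !inE /vinv -leqNgt [v <= x]leq_eqVlt.
  by case: eqP => // /ord_inj <-; rewrite !ltnn.
by move: e1 e2; clear; lia.
Qed.

(** By [posE] the inversions determine every position. *)
Lemma vinv_inj u u' : (forall y v, vinv u y v = vinv u' y v) -> u = u'.
Proof.
move=> e; apply: invg_inj; apply/permP => v; apply: val_inj => /=.
have := posE u v; have := posE u' v.
have -> : [set x | vinv u v x] = [set x | vinv u' v x] by apply/setP => x; rewrite !inE e.
have -> : [set x | vinv u x v] = [set x | vinv u' x v] by apply/setP => x; rewrite !inE e.
by move=> <- /addIn.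
Qed.

Lemma vinv1 y v : vinv 1%g y v = false.
Proof. by rewrite /vinv invg1 !perm1; lia. Qed.

Fixpoint crossings u s : seq ('I_m * 'I_m) :=
  if s is l :: s' then cross u l :: crossings (hecke_mul u l) s' else [::].

Lemma size_crossings u s : size (crossings u s) = size s.
Proof. by elim: s u => //= l s IH u; rewrite IH. Qed.

Lemma vinv_foldl u s y v :
  vinv (foldl (@hecke_mul m) u s) y v = vinv u y v || ((y, v) \in crossings u s).
Proof. by elim: s u => /= [|l s IH] u; rewrite ?orbF // IH vinv_hecke inE orbA. Qed.

(* In a run, y meets its smaller partners from right to left, and v meets its
   larger partners from left to right. *)
Definition cross_order b c : bool :=
  ~~ ((b.1 == c.1) && (b.2 < c.2)) && ~~ ((b.2 == c.2) && (c.1 < b.1)).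

Variable W : 'S_m.
Hypothesis hW : avoids321 W.

(** The value [x] would be the middle of a 321 pattern. Hence for a value taking part in an
    inversion, one of the two counts in [posE] is zero. *)
Lemma vinv_no321 y x v : vinv W y x -> vinv W x v -> False.
Proof.
move=> /andP[h1 h2] /andP[h3 h4]; apply: hW.
by exists ((W^-1)%g y), ((W^-1)%g x), ((W^-1)%g v); rewrite !permKV.
Qed.

(* The only letter at which the values of b can be compared in a word for W. *)
Definition lab b : nat := b.2 + #|[set x : 'I_m | (x < b.1) && vinv W x b.2]|.

Let below u := forall y v, vinv u y v -> vinv W y v.

Lemma pos_trich u x y : [\/ x = y, (u^-1)%g x < (u^-1)%g y | (u^-1)%g y < (u^-1)%g x].
Proof.
case: (ltngtP ((u^-1)%g x) ((u^-1)%g y)) => [?|?|/ord_inj/perm_inj ?].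
- by apply: Or32.
- by apply: Or33.
- by apply: Or31.
Qed.

(** Right after the letter, [v] stands at position [l + 1], which by [posE] is [v] plus the number
    of its larger partners so far. Avoiding 321 forces these to be [y] and all the partners in [W]
    less than [y]. *)
Lemma cross_lab u l : below (hecke_mul u l) -> lab (cross u l) = l.
Proof.
set u' := hecke_mul u l => bW; have [py pv] := cross_pos u l.
have : vinv u' (cross u l).1 (cross u l).2.
  by rewrite vinv_hecke -surjective_pairing eqxx orbT.
case: (cross u l) py pv => y v /= py pv yv.
have /andP[vy _] := yv.
have := posE u' v; rewrite pv /lab /=.
have -> : [set x | vinv u' v x] = set0.
  by apply/setP => x; rewrite !inE; apply/negP => /bW/(vinv_no321 (bW _ _ yv)).
have -> : [set x | vinv u' x v] = y |: [set x : 'I_m | (x < y) && vinv W x v].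
  apply/setP => x; rewrite !inE; case: (eqVneq x y) => [-> //|xy] /=.
  have nxy : (x : nat) <> y by move/val_inj => e; rewrite e eqxx in xy.
  case: (ltnP x y) => h /=.
    apply/idP/idP => [|xv]; first exact: bW.
    have /andP[vx _] := xv; rewrite /vinv vx pv /=.
    case: (pos_trich u' x v) => [e|h1|h1]; first by move: vx; rewrite e ltnn.
      by move: h1; rewrite pv.
    case: (@vinv_no321 y x v) => //; apply: bW; rewrite /vinv h py /=.
    by move: h1; rewrite pv /=; lia.
  apply/negP => xv; have /andP[vx pxv] := xv; case: (@vinv_no321 x y v); last exact: bW.
  apply: bW; apply/andP; split; first by move: h nxy; clear; lia.
  case: (pos_trich u' x y) => [e|//|]; first by rewrite e eqxx in xy.
  by move: pxv; rewrite pv py /=; clear; lia.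
by rewrite cards0 cardsU1 !inE ltnn /=; clear; lia.
Qed.

(** Compared values are adjacent. If [y] had already crossed some [v' < v], then [v'] would stand
    right of [v] and [y], [v], [v'] would be a 321 pattern; similarly for a partner of [v] larger
    than [y]. *)
Lemma crossings_order b u s : vinv u b.1 b.2 -> foldl (@hecke_mul m) u s = W ->
  all (cross_order b) (crossings u s).
Proof.
elim: s u => //= l s IH u bu e; set u' := hecke_mul u l in e *.
have bu' : vinv u' b.1 b.2 by rewrite vinv_hecke bu.
rewrite (IH _ bu' e) andbT.
have bW : below u' by move=> y v h; rewrite -e vinv_foldl h.
have [py pv] := cross_pos u l; rewrite -/u' in py pv.
have : vinv u' (cross u l).1 (cross u l).2.
  by rewrite vinv_hecke -surjective_pairing eqxx orbT.
case: (cross u l) py pv => y v /= py pv yv; clear IH bu; case: b bu' => y' v' /= bu'.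
have /andP[_ pb] := bu'.
apply/andP; split; apply/negP => /andP[/eqP /= e1 h]; [subst y' | subst v'].
  case: (pos_trich u' v' v) => [e1|h1|h1]; first by rewrite e1 ltnn in h.
    by move: pb h1; rewrite py pv /=; clear; lia.
  by case: (@vinv_no321 y v v'); [apply: bW | apply: bW; rewrite /vinv h].
case: (pos_trich u' y' y) => [e1|h1|h1]; first by rewrite e1 ltnn in h.
  by case: (@vinv_no321 y' y v); [apply: bW; rewrite /vinv h | apply: bW].
by move: pb h1; rewrite py pv /=; clear; lia.
Qed.

Lemma crossings_spec u s : foldl (@hecke_mul m) u s = W ->
  pairwise cross_order (crossings u s) /\ map lab (crossings u s) = map val s.
Proof.
elim: s u => //= l s IH u e; have [-> ->] := IH _ e; split.
  rewrite andbT; apply: (crossings_order _ e).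
  by rewrite vinv_hecke -surjective_pairing eqxx orbT.
by rewrite cross_lab // => y v h; rewrite -e vinv_foldl h.
Qed.

(* Every value between v and y is inverted with exactly one of them. *)
Lemma lab_between y v : vinv W y v ->
  lab (y, v) + #|[set x : 'I_m | (v < x) && vinv W y x]| + 1 = y.
Proof.
move=> yv; have /andP[vy pyv] := yv; rewrite /lab /=.
have := cardsID [set x : 'I_m | x <= v] [set x : 'I_m | x < y].
rewrite (card_ord_lt y) => ey; rewrite -[RHS]ey.
have -> : [set x : 'I_m | x < y] :&: [set x : 'I_m | x <= v] = v |: [set x : 'I_m | x < v].
  apply/setP => x; rewrite !inE [x <= v]leq_eqVlt; case: (eqVneq x v) => [->|ne]; first by rewrite eqxx vy.
  have /negPf -> : (x : nat) != v by [].
  by move: vy; clear; lia.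
have -> : [set x : 'I_m | x < y] :\: [set x : 'I_m | x <= v] =
   [set x : 'I_m | (x < y) && vinv W x v] :|: [set x : 'I_m | (v < x) && vinv W y x].
  apply/setP => x; rewrite !inE -ltnNge /vinv.
  case: (ltnP v x) => vx; rewrite ?andbF //=; case: (ltnP x y) => xy //=.
  case: (pos_trich W x y) => [e|h1|h1]; first by rewrite e ltnn in xy.
    by rewrite (ltn_trans h1 pyv).
  by rewrite h1 orbT.
rewrite cardsU1 inE ltnn (card_ord_lt v) cardsU.
rewrite [X in _ - #|pred_of_set X|](_ : _ = set0) ?cards0; first by rewrite subn0 /= addn1 -addnA add1n addSn.
apply/setP => x; rewrite !inE; apply/negP => /andP[/andP[_ h1] /andP[_ h2]].
exact: vinv_no321 h2 h1.
Qed.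

(** [posE] at [y] turns the value in [lab_between] into a position. In the Rothe diagram this says
    that the first box of row [i] has label [i] and that labels increase along the row. *)
Lemma lab_row y v : vinv W y v ->
  lab (y, v) = (W^-1)%g y + #|[set x : 'I_m | (x < v) && vinv W y x]|.
Proof.
move=> yv; have := lab_between yv; have := posE W y.
have -> : [set x | vinv W x y] = set0.
  by apply/setP => x; rewrite !inE; apply/negP => /vinv_no321/(_ yv).
have -> : [set x | vinv W y x] =
    v |: ([set x : 'I_m | (x < v) && vinv W y x] :|: [set x : 'I_m | (v < x) && vinv W y x]).
  apply/setP => x; rewrite !inE; case: (eqVneq x v) => [->|ne] //=.
  case: (ltngtP x v) => [||/val_inj e]; rewrite ?orbF //.
  by rewrite e eqxx in ne.
rewrite cards0 cardsU1 !inE !ltnn cardsU [X in _ - #|pred_of_set X|](_ : _ = set0) ?cards0; last first.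
  by apply/setP => x; rewrite !inE; clear; lia.
by clear; lia.
Qed.

(** The converse of [crossings_spec]. Once the pairs of [t1] have been crossed, the order on [t]
    makes the partners met so far the ones counted by [lab], so [posE] places [y] and [v] side by
    side at the next letter. *)
Lemma crossings_complete t : (forall b, (b \in t) = vinv W b.1 b.2) ->
  pairwise cross_order t -> forall s, map val s = map lab t ->
  crossings 1 s = t /\ foldl (@hecke_mul m) 1%g s = W.
Proof.
move=> tW pw s es; suff e : crossings 1 s = t.
  split=> //; apply: vinv_inj => y v.
  by rewrite vinv_foldl vinv1 e tW.
have H t1 t2 : t = t1 ++ t2 -> forall s u, map val s = map lab t2 ->
    (forall y v, vinv u y v = ((y, v) \in t1)) -> crossings u s = t2.
  elim: t2 t1 => [|[y v] t2 IH] t1 et [|l {}s] // u /= [el {}es] uE.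
  have yv : vinv W y v by rewrite -(tW (y, v)) et mem_cat inE eqxx orbT.
  have /andP[vy _] := yv.
  have bW : below u by move=> y' v'; rewrite uE -(tW (y', v')) et mem_cat => ->.
  have pw' : pairwise cross_order (t1 ++ (y, v) :: t2) by rewrite -et.
  move: pw'; rewrite pairwise_cat pairwise_cons => /and3P[/allrelP a12 _ /andP[/allP a2 _]].
  (* The boolean is 1 when this pair was crossed before, that is, when [y] already stands left of
     [v]. *)
  have pos_v : (u^-1)%g v = l + ((y, v) \in t1) :> nat.
    have := posE u v.
    have -> : [set x | vinv u v x] = set0.
      by apply/setP => x; rewrite !inE; apply/negP => /bW; apply: vinv_no321 yv.
    have -> : [set x | vinv u x v] = [set x : 'I_m | ((y, v) \in t1) && (x == y)]
        :|: [set x : 'I_m | (x < y) && vinv W x v].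
      apply/setP => x; rewrite !inE uE; case: (eqVneq x y) => [->|xy].
        by rewrite ltnn orbF andbT.
      rewrite andbF /=; apply/idP/idP.
        move=> xt; rewrite bW ?uE // andbT.
        have := a12 _ (y, v) xt (mem_head _ _); rewrite /cross_order /= eqxx /=.
        by move=> /andP[_]; rewrite -leqNgt leq_eqVlt -[(x : nat) == y]/(x == y) (negPf xy).
      move=> /andP[lt xv]; have : (x, v) \in t by rewrite tW.
      rewrite et mem_cat inE xpair_eqE (negPf xy) /= => /orP[//|/a2].
      by rewrite /cross_order /= eqxx lt /= andbF.
    rewrite cardsU [X in (_ - #|pred_of_set X|)](_ : _ = set0) ?cards0; last first.
      apply/setP => x; rewrite !inE; apply/negP => /andP[/andP[_ /eqP ->]].
      by rewrite ltnn.
    have -> : #|[set x : 'I_m | ((y, v) \in t1) && (x == y)]| = ((y, v) \in t1).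
      case: (_ \in t1) => /=; first by rewrite -[RHS](cards1 y); apply: eq_card => x; rewrite !inE.
      by apply: eq_card0 => x; rewrite inE.
    by move: el; rewrite /lab /= => ->; clear; lia.
  have pos_y : (u^-1)%g y + ((y, v) \in t1) = l + 1 :> nat.
    have := posE u y.
    have -> : [set x | vinv u x y] = set0.
      by apply/setP => x; rewrite !inE; apply/negP => /bW/vinv_no321/(_ yv).
    have -> : [set x | vinv u y x] = [set x : 'I_m | ((y, v) \in t1) && (x == v)]
        :|: [set x : 'I_m | (v < x) && vinv W y x].
      apply/setP => x; rewrite !inE uE; case: (eqVneq x v) => [->|xv].
        by rewrite ltnn orbF andbT.
      rewrite andbF /=; apply/idP/idP.
        move=> xt; rewrite bW ?uE // andbT.
        have := a12 _ (y, v) xt (mem_head _ _); rewrite /cross_order /= eqxx /=.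
        by move=> /andP[+ _]; rewrite -leqNgt leq_eqVlt -[(v : nat) == x]/(v == x) eq_sym (negPf xv).
      move=> /andP[lt yx]; have : (y, x) \in t by rewrite tW.
      rewrite et mem_cat inE xpair_eqE (negPf xv) andbF /= => /orP[//|/a2].
      by rewrite /cross_order /= eqxx lt.
    rewrite cardsU [X in (_ - #|pred_of_set X|)](_ : _ = set0) ?cards0; last first.
      apply/setP => x; rewrite !inE; apply/negP => /andP[/andP[_ /eqP ->]].
      by rewrite ltnn.
    have -> : #|[set x : 'I_m | ((y, v) \in t1) && (x == v)]| = ((y, v) \in t1).
      case: (_ \in t1) => /=; first by rewrite -[RHS](cards1 v); apply: eq_card => x; rewrite !inE.
      by apply: eq_card0 => x; rewrite inE.
    by have := lab_between yv; rewrite -el; clear; lia.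
  have ec : cross u l = (y, v).
    rewrite /cross; case E : ((y, v) \in t1) pos_v pos_y => /= pos_v pos_y.
      have -> : sleft l = (u^-1)%g y by apply: val_inj => /=; move: pos_y; clear; lia.
      have -> : sright l = (u^-1)%g v by apply: val_inj => /=; move: pos_v; clear; lia.
      by rewrite !permKV ltnNge (ltnW vy).
    have -> : sleft l = (u^-1)%g v by apply: val_inj => /=; move: pos_v; clear; lia.
    have -> : sright l = (u^-1)%g y by apply: val_inj => /=; move: pos_y; clear; lia.
    by rewrite !permKV vy.
  rewrite ec; congr cons; apply: (IH (rcons t1 (y, v))) => //.
    by rewrite cat_rcons.
  by move=> y' v'; rewrite vinv_hecke ec uE mem_rcons inE orbC.
by apply: (H [::]) => // y v; rewrite vinv1.
Qed.

Lemma lab_lt_row y v v' : vinv W y v -> v < v' -> vinv W y v' -> lab (y, v) < lab (y, v').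
Proof.
move=> h lt h'; rewrite (lab_row h) (lab_row h') ltn_add2l; apply: proper_card.
apply/properP; split; last by exists v; rewrite !inE ?ltnn ?lt.
by apply/subsetP => x; rewrite !inE => /andP[xv ->]; rewrite andbT (ltn_trans xv lt).
Qed.

Lemma lab_lt_col y y' v : vinv W y v -> y < y' -> lab (y, v) < lab (y', v).
Proof.
move=> h lt; rewrite /lab ltn_add2l; apply: proper_card.
apply/properP; split; last by exists y; rewrite !inE ?ltnn //= lt h.
by apply/subsetP => x; rewrite !inE => /andP[xv ->]; rewrite andbT (ltn_trans xv lt).
Qed.

(** In the count of [lab_row], passing from [y] to [y'] loses at most the values standing strictly
    between them, one fewer than the gain in position. *)
Lemma lab_lt_SE y y' v v' : vinv W y v -> vinv W y' v' ->
  (W^-1)%g y < (W^-1)%g y' -> v < v' -> lab (y, v) < lab (y', v').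
Proof.
move=> h h' py vv; rewrite (lab_row h) (lab_row h').
set A := [set x | _]; set A' := [set x | _].
pose C := [set x : 'I_m | (W^-1)%g y < (W^-1)%g x < (W^-1)%g y'].
have /andP[vy _] := h; have /andP[vy' _] := h'.
have sub : A \subset A' :|: C.
  apply/subsetP => x; rewrite !inE /vinv => /andP[xv /andP[xy pyx]].
  rewrite (ltn_trans xv vv) (ltn_trans xv (ltn_trans vv vy')) pyx /=.
  case: (pos_trich W y' x) => [e|->|->] //; last by rewrite orbT.
  by move: xv vv vy'; rewrite -e; clear; lia.
have cC : #|C| + (W^-1)%g y + 1 = (W^-1)%g y'.
  have -> : #|C| = #|[set z : 'I_m | (W^-1)%g y < z < (W^-1)%g y']|.
    rewrite -[RHS](card_preimset _ (@perm_inj _ (W^-1)%g)).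
    by apply: eq_card => x; rewrite !inE.
  have := cardsID [set z : 'I_m | z <= (W^-1)%g y] [set z : 'I_m | z < (W^-1)%g y'].
  rewrite (card_ord_lt ((W^-1)%g y')) => ey; rewrite -[RHS]ey.
  have -> : [set z : 'I_m | z < (W^-1)%g y'] :&: [set z : 'I_m | z <= (W^-1)%g y] =
    (W^-1)%g y |: [set z : 'I_m | z < (W^-1)%g y].
    apply/setP => x; rewrite !inE [x <= _]leq_eqVlt.
    case: (eqVneq x ((W^-1)%g y)) => [->|ne]; first by rewrite eqxx py.
    have /negPf -> : (x : nat) != (W^-1)%g y by [].
    by move: py; clear; lia.
  rewrite cardsU1 inE ltnn (card_ord_lt ((W^-1)%g y)).
  rewrite /= add1n addn1 addSn addnC; congr (_ + _).+1.
  by apply: eq_card => x; rewrite !inE -ltnNge.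
have := leq_trans (subset_leq_card sub) (leq_card_setU A' C); move: cC py; clear; lia.
Qed.

End HeckeWords.

(** * Pipe dreams and fillings *)

Section Extend.
Variables (n : nat) (w : 'S_n).
Implicit Types (i j : 'I_n) (b : 'I_n * 'I_n).

Lemma extendL i : extend w (lshift n i) = lshift n (w i).
Proof. by rewrite permE /extend_fun -[lshift n i]/(unsplit (inl i)) unsplitK. Qed.

Lemma extendR i : extend w (rshift n i) = rshift n i.
Proof. by rewrite permE /extend_fun -[rshift n i]/(unsplit (inr i)) unsplitK. Qed.

Lemma extendVL j : ((extend w)^-1 (lshift n j) = lshift n (w^-1 j))%g.
Proof. by apply: (@perm_inj _ (extend w)); rewrite permKV extendL permKV. Qed.

Lemma extendVR j : ((extend w)^-1 (rshift n j) = rshift n j)%g.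
Proof. by apply: (@perm_inj _ (extend w)); rewrite permKV extendR. Qed.

Lemma avoids321_extend : avoids321 w -> avoids321 (extend w).
Proof.
move=> hw [a [b [c []]]].
case: (split_ordP a) => a' -> ; case: (split_ordP b) => b' ->; case: (split_ordP c) => c' ->;
  rewrite ?extendL ?extendR /= => h1 h2 h3 h4; first by apply: hw; exists a', b', c'.
all: by move: h1 h2 h3 h4 (ltn_ord b') (ltn_ord c') (ltn_ord (w a')) (ltn_ord (w b')); clear; lia.
Qed.

Definition value_pair b : 'I_(n + n) * 'I_(n + n) := (lshift n (w b.1), lshift n b.2).

Lemma value_pair_inj : injective value_pair.
Proof. by move=> [i j] [i' j'] [/ord_inj/perm_inj-> /ord_inj->]. Qed.

Lemma vinv_value_pair b :
  vinv (extend w) (value_pair b).1 (value_pair b).2 = (b \in rothe w).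
Proof. by case: b => i j; rewrite in_rothe /vinv !extendVL permK. Qed.

Lemma vinv_extendP y v : reflect (exists2 b, b \in rothe w & (y, v) = value_pair b)
  (vinv (extend w) y v).
Proof.
apply: (iffP idP) => [|[b bw [-> ->]]]; last by rewrite -vinv_value_pair in bw.
case: (split_ordP y) => y' ->; case: (split_ordP v) => v' ->.
- have -> : lshift n y' = lshift n (w ((w^-1)%g y')) by rewrite permKV.
  move=> h; exists ((w^-1)%g y', v') => //.
  by rewrite -vinv_value_pair.
- by rewrite /vinv /=; move: (ltn_ord y'); clear; lia.
- by rewrite /vinv extendVR extendVL /=; move: (ltn_ord ((w^-1)%g v')); clear; lia.
- by rewrite /vinv !extendVR /=; clear; lia.
Qed.

End Extend.

(** * Pipe dreams as ordered assignments of crossings *)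

Section ReadingOrder.
Variable n : nat.
Implicit Types (q : 'I_n * 'I_n) (P : {set 'I_n * 'I_n}).

Definition reading : seq ('I_n * 'I_n) :=
  [seq (i, k) | i <- enum 'I_n, k <- rev (enum 'I_n)].

Definition reads_before q q' : bool := (q.1 < q'.1) || (q.1 == q'.1) && (q'.2 < q.2).

Lemma mem_reading q : q \in reading.
Proof. by case: q => i k; apply/allpairsP; exists (i, k); rewrite ?mem_rev !mem_enum. Qed.

Lemma reading_pairwise : pairwise reads_before reading.
Proof.
rewrite /reading.
have hs : pairwise (fun i j : 'I_n => i < j) (enum 'I_n).
  rewrite -[pairwise _ _]/(pairwise (relpre val ltn) (enum 'I_n)) -pairwise_map.
  by rewrite val_enum_ord -(sorted_pairwise ltn_trans) iota_ltn_sorted.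
have ht : pairwise (fun i j : 'I_n => j < i) (rev (enum 'I_n)).
  have tr : transitive (fun i j : 'I_n => j < i) by move=> y x z /=; clear; lia.
  rewrite -(sorted_pairwise tr) rev_sorted.
  have tr' : transitive (fun i j : 'I_n => i < j) by move=> y x z /=; clear; lia.
  by rewrite (sorted_pairwise tr').
elim: (enum 'I_n) hs (rev _) ht => //= i s IH /andP[/allP his hs] t ht.
rewrite pairwise_cat IH // pairwise_map andbT; apply/andP; split.
  apply/allrelP => _ _ /mapP[k _ ->] /allpairsP[[i' k'] /= [/his h _ ->]].
  by rewrite /reads_before /= h.
by apply: sub_pairwise ht => k k' /= h; rewrite /reads_before /= eqxx h orbT.
Qed.

Lemma reads_before_asym q q' : reads_before q q' -> ~~ reads_before q' q.
Proof.
rewrite /reads_before; case: q q' => [i k] [i' k'] /=.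
case: (eqVneq i i') => [->|_]; [rewrite ?eqxx ltnn /= | rewrite /= !orbF]; clear; lia.
Qed.

Lemma reads_before_total q q' : q = q' \/ (reads_before q q' \/ reads_before q' q).
Proof.
case: q q' => [i k] [i' k']; rewrite /reads_before /=.
case: (ltngtP i i') => [||/ord_inj ->]; [by right;left|by right; right|].
rewrite eqxx /=; case: (ltngtP k k') => [||/ord_inj ->]; [by right;right|by right;left|by left].
Qed.

Lemma reading_pairwiseP P (r : rel ('I_n * 'I_n)) :
  reflect {in P &, forall q q', reads_before q q' -> r q q'}
    (pairwise r [seq q <- reading | q \in P]).
Proof.
set L := filter _ _.
have memL q : (q \in L) = (q \in P) by rewrite mem_filter mem_reading andbT.
have pw : pairwise reads_before L := pairwise_filter _ reading_pairwise.
apply: (iffP idP) => [pr q q' qP q'P lt|h]; last first.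
  apply: (@sub_in_pairwise _ (mem P) reads_before) pw => //.
  by apply/allP => q; rewrite memL.
have := conj pw pr => /andP; rewrite -pairwise_relI => /(pairwiseP q) H.
have iq : index q L < size L by rewrite index_mem memL.
have iq' : index q' L < size L by rewrite index_mem memL.
case: (ltngtP (index q L) (index q' L)) => [lt'|lt'|e].
- by have := H _ _ iq iq' lt'; rewrite !nth_index ?memL // => /andP[].
- have := H _ _ iq' iq lt'; rewrite !nth_index ?memL // => /andP[/reads_before_asym].
  by rewrite lt.
- have : q = q' by rewrite -(nth_index q (s := L) (x := q)) ?memL // e nth_index ?memL.
  by move=> eq; have := reads_before_asym lt; rewrite -eq; move: lt; rewrite -eq => ->.
Qed.

Lemma pd_wordE P : pd_word P = map (@box_label n) [seq q <- reading | q \in P].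
Proof. by []. Qed.

Variable w : 'S_n.
Hypothesis hw : avoids321 w.
Let W := extend w.
Let hW : avoids321 W := avoids321_extend hw.

(** By the two lemmas that follow, such an [f] exists exactly when [demazure P = W], and then lists
    the crossings of the word of [P]. This replaces words by conditions on boxes. *)
Definition cross_assign P (f : 'I_n * 'I_n -> 'I_(n + n) * 'I_(n + n)) : Prop :=
  [/\ {in P, forall q, lab W (f q) = q.1 + q.2},
      {in P &, forall q q', reads_before q q' -> cross_order (f q) (f q')}
    & forall b, vinv W b.1 b.2 <-> exists2 q, q \in P & f q = b].

Lemma cross_assign_demazure P f : cross_assign P f ->
  map f [seq q <- reading | q \in P] = crossings 1 (pd_word P) /\ demazure P = W.
Proof.
move=> [h1 h2 h3]; rewrite /demazure pd_wordE.
set L := filter _ _.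
have memL q : (q \in L) = (q \in P) by rewrite mem_filter mem_reading andbT.
have hA b : (b \in map f L) = vinv W b.1 b.2.
  apply/mapP/idP => [[q]|/h3[q qP <-]]; last by exists q; rewrite ?memL.
  by rewrite memL => qP ->; apply/h3; exists q.
have hB : pairwise (@cross_order _) (map f L).
  by rewrite pairwise_map; apply/reading_pairwiseP.
have hC : map val (map (@box_label n) L) = map (lab W) (map f L).
  by rewrite -!map_comp; apply/eq_in_map => q; rewrite memL => /h1 /= ->.
by have [-> ->] := crossings_complete hW hA hB hC.
Qed.

Lemma demazure_cross_assign P : demazure P = W -> exists f, cross_assign P f.
Proof.
rewrite /demazure pd_wordE => e; have [pw el] := crossings_spec hW e.
set L := filter _ _ in e pw el.
have memL q : (q \in L) = (q \in P) by rewrite mem_filter mem_reading andbT.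
have uL : uniq L.
  apply: (@pairwise_uniq _ reads_before); last exact: pairwise_filter reading_pairwise.
  by move=> q; apply/negP => h; have := reads_before_asym h; rewrite h.
set t := crossings _ _ in pw el.
have st : size t = size L by rewrite size_crossings size_map.
have inW b : vinv W b.1 b.2 = (b \in t).
  by rewrite -e vinv_foldl vinv1 /= -surjective_pairing.
(* Without crossings no pair is available as the default of [nth]; then [P] is empty and any
   function serves. *)
case: (posnP (size t)) => [t0|t0].
  have P0 q : q \in P = false by rewrite -memL; apply/negP => /nthP; move: t0; rewrite st => -> /(_ q)[].
  exists (value_pair w); split=> [q|q q'|b]; rewrite ?P0 //.
  rewrite inW; move/size0nil: t0 => ->; split=> // -[q]; by rewrite P0.
have [b0 _] : exists b0, b0 \in t by case: (t) t0 => // b0 t'; exists b0; rewrite mem_head.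
pose f q := nth b0 t (index q L).
have tE : t = map f L.
  apply: (@eq_from_nth _ b0); first by rewrite size_map.
  move=> k kt; have q0 : 'I_n * 'I_n.
    by move: kt; rewrite st; case: (L) => // q0.
  by rewrite (nth_map q0) -?st // /f index_uniq -?st.
exists f; split=> [q qP||b].
- move: el; rewrite tE -!map_comp => /eq_in_map/(_ q).
  by rewrite memL => /(_ qP).
- by apply/reading_pairwiseP; move: pw; rewrite {1}tE pairwise_map.
- rewrite inW tE; split=> [/mapP[q]|[q qP <-]]; first by rewrite memL => ? ->; exists q.
  by apply: map_f; rewrite memL.
Qed.

End ReadingOrder.

(** * The bijection between fillings and pipe dreams *)

Section PipeDreamTableaux.
Variables (n : nat) (w : 'S_n).
Hypothesis hw : avoids321 w.
Implicit Types (i j r k : 'I_n) (b q : 'I_n * 'I_n) (T : filling n).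
Let W := extend w.
Let hW : avoids321 W := avoids321_extend hw.

Definition blab b : nat := lab W (value_pair w b).

(** A descent would complete to a 321 pattern with the value [j]. Down a column, the order by rows
    is thus the order by values used in [cross_order]. *)
Lemma rothe_col_mono i i' j :
  (i, j) \in rothe w -> (i', j) \in rothe w -> i < i' -> w i < w i'.
Proof.
rewrite !in_rothe => /andP[h1 h2] /andP[h3 h4] ii.
case: (ltngtP (w i) (w i')) => // [h|/ord_inj/perm_inj e]; last by rewrite e ltnn in ii.
by case: hw; exists i, i', ((w^-1)%g j); rewrite permKV.
Qed.

Lemma blab_lt_row i j j' : (i, j) \in rothe w -> (i, j') \in rothe w -> j < j' ->
  blab (i, j) < blab (i, j').
Proof. by rewrite -!vinv_value_pair => h h' lt; apply: (@lab_lt_row _ W hW _ _ (lshift n j') h lt h'). Qed.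

Lemma blab_lt_col i i' j : (i, j) \in rothe w -> (i', j) \in rothe w -> i < i' ->
  blab (i, j) < blab (i', j).
Proof.
move=> h h' lt; have ww := rothe_col_mono h h' lt.
by rewrite -vinv_value_pair in h; apply: (@lab_lt_col _ W _ (lshift n (w i')) _ h ww).
Qed.

Lemma blab_lt_SE i i' j j' : (i, j) \in rothe w -> (i', j') \in rothe w ->
  i < i' -> j < j' -> blab (i, j) < blab (i', j').
Proof.
rewrite -!vinv_value_pair => h h' ii jj; apply: (@lab_lt_SE _ W hW _ _ _ _ h h') => //.
by rewrite !extendVL !permK.
Qed.

(** As rows in [T b] are at most [b.1], these bounds keep the box of label [blab b] in such a row
    inside the grid. *)
Lemma blab_bounds b : b \in rothe w -> b.1 <= blab b < n.-1.
Proof.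
rewrite -vinv_value_pair => h; apply/andP; split.
  by rewrite /blab [value_pair w b]surjective_pairing (lab_row hW h) /= extendVL permK leq_addr.
have := lab_between hW h; rewrite -surjective_pairing -/(blab b) /=.
by move: (ltn_ord (w b.1)); clear; lia.
Qed.

(* Equal labels lie on an antidiagonal, whose NW corner separates the fillings. *)
Lemma blab_inj T r b b' : svt w T -> r \in T b -> r \in T b' -> blab b = blab b' -> b = b'.
Proof.
move=> sT; have /svtP[h0 hr hc hf] := sT; case: b => i j; case: b' => i' j'.
wlog lt : i j i' j' / i <= i'.
  by move=> H h h' e; case: (leqP i i') => ii; [apply: H | symmetry; apply: H => //; apply: ltnW].
move=> h h' e; have bw := svt_rothe sT h; have bw' := svt_rothe sT h'.
case: (ltngtP i i') lt => // [lt _|/ord_inj ei _].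
  case: (ltngtP j j') => [jj|jj|/ord_inj ej].
  - by have := blab_lt_SE bw bw' lt jj; rewrite e ltnn.
  - have := rothe_NW lt jj bw bw'; rewrite -h0 => /set0Pn[t ht].
    by have := hr _ _ _ _ _ ht h jj; have := hc _ _ _ _ _ ht h' lt; clear; lia.
  - by subst j'; have := blab_lt_col bw bw' lt; rewrite e ltnn.
subst i'; case: (ltngtP j j') => [jj|jj|/ord_inj -> //].
- by have := blab_lt_row bw bw' jj; rewrite e ltnn.
- by have := blab_lt_row bw' bw jj; rewrite e ltnn.
Qed.

Definition pd T : {set 'I_n * 'I_n} :=
  [set q : 'I_n * 'I_n | [exists b, (q.1 \in T b) && (blab b == q.1 + q.2)]].

Lemma pdP T q : reflect (exists2 b, q.1 \in T b & blab b = q.1 + q.2) (q \in pd T).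
Proof.
rewrite inE; apply: (iffP existsP) => [[b /andP[? /eqP]]|[b h e]]; exists b => //.
by rewrite h e eqxx.
Qed.

Lemma pd_mem T r b : svt w T -> r \in T b -> exists2 k, (r, k) \in pd T & blab b = r + k.
Proof.
move=> sT rT; have /svtP[h0 hr hc hf] := sT; have bw := svt_rothe sT rT.
have /andP[h1 h2] := blab_bounds bw.
have rb : r <= b.1 by case: b rT {bw h1 h2} => i j; apply: hf.
have kn : blab b - r < n by move: h2; clear; lia.
exists (Ordinal kn); last by move: rb h1; clear; rewrite /=; lia.
by apply/pdP; exists b => //=; move: rb h1; clear; lia.
Qed.

(* The default value is never used on [pd T]. *)
Definition pd_box T q : 'I_n * 'I_n :=
  odflt q [pick b | (q.1 \in T b) && (blab b == q.1 + q.2)].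

Lemma pd_boxP T q : q \in pd T -> q.1 \in T (pd_box T q) /\ blab (pd_box T q) = q.1 + q.2.
Proof.
move=> /pdP[b h e]; rewrite /pd_box; case: pickP => [b' /andP[? /eqP]|/(_ b)] //=.
by rewrite h e eqxx.
Qed.

Lemma pd_box_eq T q b : svt w T -> q.1 \in T b -> blab b = q.1 + q.2 -> pd_box T q = b.
Proof.
move=> sT h e; have qT : q \in pd T by apply/pdP; exists b.
by have [h' e'] := pd_boxP qT; apply: (blab_inj sT h' h); rewrite e e'.
Qed.

(** Within one row of the grid larger labels are read first. This is the order [cross_order] asks
    along a row of the Rothe diagram and the opposite of what it asks down a column, so fillings may
    tie along rows but not down columns. *)
Lemma pd_cross_assign T : svt w T -> cross_assign w (pd T) (value_pair w \o pd_box T).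
Proof.
move=> sT; have /svtP[h0 hr hc hf] := sT; split=> [q qT|q q' qT qT' lt|[y v]].
- by have [_] := pd_boxP qT.
- have [h e] := pd_boxP qT; have [h' e'] := pd_boxP qT'.
  have bw := svt_rothe sT h; have bw' := svt_rothe sT h'.
  rewrite /= /cross_order /=; move: (pd_box T q) (pd_box T q') h e h' e' bw bw'.
  move=> [i j] [i' j'] /= h e h' e' bw bw'; apply/andP; split; apply/negP => /andP[].
    move=> /eqP/lshift_inj/perm_inj ei jj; subst i'.
    have := hr _ _ _ _ _ h h' jj; have := blab_lt_row bw bw' jj; rewrite e e'.
    move: lt; rewrite /reads_before; case: (eqVneq q.1 q'.1) => [->|_] /=; last by clear; lia.
    by rewrite ltnn /=; clear; lia.
  move=> /eqP/lshift_inj ej ww; subst j'.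
  have ii : i' < i.
    case: (ltngtP i i') => // [ii|/ord_inj ei]; last by rewrite ei ltnn in ww.
    by have := rothe_col_mono bw bw' ii; move: ww; clear; lia.
  have := hc _ _ _ _ _ h' h ii; move: lt; rewrite /reads_before.
  by case: (eqVneq q.1 q'.1) => [->|_] /=; clear; lia.
- split=> [/vinv_extendP[b bw ->]|[q qT <-]].
    move: (bw); rewrite -h0 => /set0Pn[r rb]; have [k kT e] := pd_mem sT rb.
    by exists (r, k) => //=; rewrite (@pd_box_eq T (r, k) b sT rb e).
  have [h _] := pd_boxP qT; have := svt_rothe sT h.
  by rewrite -vinv_value_pair.
Qed.

Lemma demazure_pd T : svt w T -> demazure (pd T) = W.
Proof. by move=> /pd_cross_assign/(cross_assign_demazure hw)[]. Qed.

(** The box to which an entry belongs is its crossing in the word, which depends on the pipe dream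
    alone. *)
Lemma pd_inj : {in svt w &, injective pd}.
Proof.
move=> T T' sT sT' e.
have H (A B : filling n) : svt w A -> svt w B -> pd A = pd B -> forall b, A b \subset B b.
  move=> sA sB eAB b; apply/subsetP => r rA; have [k kA ek] := pd_mem sA rA.
  have [eA _] := cross_assign_demazure hw (pd_cross_assign sA).
  have [eB _] := cross_assign_demazure hw (pd_cross_assign sB).
  rewrite -eAB -eA in eB; move/eq_in_map/(_ (r, k)): eB.
  rewrite mem_filter mem_reading kA /= => /(_ isT)/value_pair_inj.
  rewrite (@pd_box_eq A (r, k) b sA rA ek) => <-.
  by rewrite eAB in kA; have [] := pd_boxP kA.
apply/ffunP => b; apply/eqP; rewrite eqEsubset.
by rewrite (H T T') // (H T' T).
Qed.

Lemma demazure_svt (P : {set 'I_n * 'I_n}) : demazure P = W -> exists2 T, svt w T & pd T = P.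
Proof.
move=> /(demazure_cross_assign hw)[f [h1 h2 h3]].
pose T : filling n := [ffun b => [set r | [exists k, ((r, k) \in P) && (f (r, k) == value_pair w b)]]].
have TP r b : r \in T b -> exists2 k, (r, k) \in P & f (r, k) = value_pair w b.
  by rewrite ffunE inE => /existsP[k /andP[? /eqP]]; exists k.
have PT r b k : (r, k) \in P -> f (r, k) = value_pair w b -> r \in T b.
  by move=> h e; rewrite ffunE inE; apply/existsP; exists k; rewrite h e eqxx.
have T0 b : (T b != set0) = (b \in rothe w).
  rewrite -vinv_value_pair; apply/set0Pn/idP => [[r /TP[k h e]]|].
    by apply/h3; exists (r, k).
  by move=> /h3[[r k] h e]; exists r; apply: (PT _ _ k); rewrite // -surjective_pairing in e *.
have Tw b r : r \in T b -> b \in rothe w by move=> h; rewrite -T0; apply/set0Pn; exists r.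
have Tl b r k : (r, k) \in P -> f (r, k) = value_pair w b -> blab b = r + k.
  by move=> h e; rewrite /blab -e h1.
have Trow i j j' r s : r \in T (i, j) -> s \in T (i, j') -> j < j' -> s <= r.
  move=> /TP[k rk e] /TP[k' sk e'] jj.
  case: (reads_before_total (r, k) (s, k')) => [[-> _] //|[lt|]].
    by have := h2 _ _ rk sk lt; rewrite e e' /cross_order /= eqxx jj.
  by rewrite /reads_before /= => /orP[/ltnW //|/andP[/eqP->]].
exists T.
  apply/svtP; split=> // [i i' j r s rT sT ii|i j r rT].
    have bw := Tw _ _ rT; have bw' := Tw _ _ sT.
    have [k rk e] := TP _ _ rT; have [k' sk e'] := TP _ _ sT.
    have lt := blab_lt_col bw bw' ii; rewrite (Tl _ _ _ rk e) (Tl _ _ _ sk e') in lt.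
    case: (reads_before_total (r, k) (s, k')) => [[er ek]|[]].
    - by subst; rewrite ltnn in lt.
    - rewrite /reads_before /= => /orP[//|/andP[/eqP er kk]].
      by subst; move: lt kk; clear; lia.
    - move/(h2 _ _ sk rk); rewrite e e' /cross_order /= eqxx /=.
      by rewrite (rothe_col_mono bw bw' ii) /= andbF.
  (* The bound [r <= i] comes from the first box [(i, j0)] of the row: its label is [i], so its
     entries are at most [i], and entries weakly decrease to the right. *)
  have ij := Tw _ _ rT; pose j0 := [arg min_(j' < j | (i, j') \in rothe w) (j' : nat)].
  have [ij0 jmin] : (i, j0) \in rothe w /\ forall j', (i, j') \in rothe w -> j0 <= j'.
    by rewrite /j0; case: arg_minnP.
  have [r0 r0T rr0] : exists2 r0, r0 \in T (i, j0) & r <= r0.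
    case: (ltngtP j0 j) (jmin _ ij) => // [jj _|/ord_inj -> _]; last by exists r.
    by move: ij0; rewrite -T0 => /set0Pn[r0 r0T]; exists r0 => //; apply: Trow r0T rT jj.
  have [k r0k e] := TP _ _ r0T; have el := Tl _ _ _ r0k e.
  move: ij0 el; rewrite -vinv_value_pair => ij0; rewrite /blab [value_pair _ _]surjective_pairing.
  rewrite (lab_row hW ij0) /= extendVL permK [X in #|pred_of_set X|](_ : _ = set0).
    by rewrite cards0 addn0 /= => ei; move: ei rr0; clear; lia.
  apply/setP => x; rewrite !inE; apply/negP => /andP[xj /vinv_extendP[[i1 j1] bw1]].
  move=> [/ord_inj/perm_inj /= ei ex]; subst i1.
  by have := jmin _ bw1; move: xj; rewrite ex /=; clear; lia.
apply/setP => -[r k]; apply/pdP/idP => /= [[b /TP[k' rk' e] el]|rk].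
  have := Tl _ _ _ rk' e; rewrite el => /addnI/ord_inj ek; by rewrite ek.
have : vinv W (f (r, k)).1 (f (r, k)).2 by apply/h3; exists (r, k).
move=> /vinv_extendP[b bw]; rewrite -surjective_pairing => e; exists b.
  exact: PT rk e.
exact: Tl rk e.
Qed.

Lemma pd_imset : [set P | demazure P == W] = [set pd T | T in [set T | svt w T]].
Proof.
apply/setP => P; rewrite inE; apply/eqP/imsetP => [/demazure_svt[T sT <-]|[T + ->]].
  by exists T; rewrite ?inE.
by rewrite inE; apply: demazure_pd.
Qed.

(** Both sides count the [b] with [r \in T b]: the diagram tells them apart by their column, the
    pipe dream by their label. *)
Lemma wt_pd T : svt w T -> wt (pd T) = wt (boxes (dg T)).
Proof.
move=> sT; apply/mnmP => r; rewrite !mnmE.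
have inj1 : {in [set b | r \in T b] &, injective (fun b : 'I_n * 'I_n => b.2)}.
  move=> [i j] [i' j']; rewrite !inE => h h' /= e; subst j'.
  by rewrite (svt_row_uniq sT h h').
pose g b : 'I_n := insubd r (blab b - r).
have gE b : r \in T b -> g b = blab b - r :> nat.
  by move=> /(pd_mem sT)[k _ e]; rewrite /g val_insubd e addKn ltn_ord.
have inj2 : {in [set b | r \in T b] &, injective g}.
  move=> b b'; rewrite !inE => h h' /(congr1 val) /=; rewrite !gE // => e.
  apply: (blab_inj sT h h'); have [k _ ek] := pd_mem sT h; have [k' _ ek'] := pd_mem sT h'.
  by move: e; rewrite ek ek' !addKn => ->.
transitivity #|[set b | r \in T b]|.
  rewrite -(card_in_imset inj2); congr #|pred_of_set _|; apply/setP => k.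
  rewrite inE; apply/pdP/imsetP => /= [[b h e]|[b]].
    by exists b; rewrite ?inE //; apply: ord_inj; rewrite gE // e addKn.
  rewrite inE => h ek; exists b => //; rewrite ek gE //.
  by have [k' _ ->] := pd_mem sT h; rewrite addKn.
rewrite -(card_in_imset inj1); congr #|pred_of_set _|; apply/setP => j.
rewrite [RHS]inE; apply/imsetP/in_boxes_dg => [[[i j'] + ->]|[i h]].
  by rewrite inE; exists i.
by exists (i, j); rewrite ?inE.
Qed.

End PipeDreamTableaux.

(** * Pipe dream formula for Grothendieck polynomials *)

Local Open Scope ring_scope.

Section HeckeRelations.
Variable m : nat.
Implicit Types (u : 'S_m) (l : 'I_m.-1) (x : 'I_m).

(** A 0-Hecke generator sorts two neighbouring values into decreasing order, so its relations reduce
    to identities between [maxn] and [minn]. *)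
Lemma hecke_val u l x : hecke_mul u l x =
  (if x == sleft l then maxn (u (sleft l)) (u (sright l))
   else if x == sright l then minn (u (sleft l)) (u (sright l)) else u x) :> nat.
Proof.
rewrite hecke_mulE; case: (asc_or_desc u l) => h.
  rewrite h rmul_simpleE /simple (maxn_idPr (ltnW h)) (minn_idPl (ltnW h)).
  by case: tpermP => [->|->|/eqP/negPf-> /eqP/negPf->] //; rewrite ?eqxx // eq_sym (negPf (sleft_neq_sright l)).
rewrite ltnNge (ltnW h) /= (maxn_idPl (ltnW h)) (minn_idPr (ltnW h)).
by case: eqP => [->|_] //; case: eqP => [->|].
Qed.

(* Total on nat letters: letters out of range act trivially. *)
Definition hmul u (k : nat) : 'S_m := if insub k is Some l then hecke_mul u l else u.

Lemma hmul_ord u (l : 'I_m.-1) : hmul u l = hecke_mul u l.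
Proof. by rewrite /hmul valK. Qed.

Lemma hmul_out k : (m.-1 <= k)%N -> forall u, hmul u k = u.
Proof. by move=> h u; rewrite /hmul insubF // ltnNge h. Qed.

Lemma hmul_id u k : hmul (hmul u k) k = hmul u k.
Proof.
case: (ltnP k m.-1) => [km|/hmul_out ho]; last by rewrite !ho.
rewrite -[k]/(val (Ordinal km)) !hmul_ord; move: (Ordinal km) => l.
apply/permP => x; apply: val_inj => /=.
rewrite !hecke_val eqxx [sright l == _]eq_sym (negPf (sleft_neq_sright l)) eqxx.
by case: eqP => // _; [lia | case: eqP => // _; lia].
Qed.

Lemma hmul_comm u k k' : (k.+1 < k')%N -> hmul (hmul u k) k' = hmul (hmul u k') k.
Proof.
case: (ltnP k m.-1) => [km|/hmul_out ho _]; last by rewrite !ho.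
case: (ltnP k' m.-1) => [km'|/hmul_out ho _]; last by rewrite !ho.
rewrite -[k]/(val (Ordinal km)) -[k']/(val (Ordinal km')) !hmul_ord.
move: (Ordinal km) (Ordinal km') => l l' /= lt.
apply/permP => x; apply: val_inj => /=; rewrite !hecke_val.
have n1 : (sleft l == sleft l') = false by rewrite -val_eqE /=; lia.
have n2 : (sleft l == sright l') = false by rewrite -val_eqE /=; lia.
have n3 : (sright l == sleft l') = false by rewrite -val_eqE /=; lia.
have n4 : (sright l == sright l') = false by rewrite -val_eqE /=; lia.
rewrite ![sleft l' == _]eq_sym ![sright l' == _]eq_sym n1 n2 n3 n4.
case: (eqVneq x (sleft l)) => [->|x1]; first by rewrite n1 n2.
case: (eqVneq x (sright l)) => [->|x2]; first by rewrite n3 n4.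
by [].
Qed.

Lemma hmul_braid u k : (k.+1 < m.-1)%N ->
  hmul (hmul (hmul u k) k.+1) k = hmul (hmul (hmul u k.+1) k) k.+1.
Proof.
move=> km; have km' : (k < m.-1)%N by lia.
pose l := Ordinal km'; pose l' := Ordinal km.
rewrite -[k.+1]/(val l') -[k]/(val l) !hmul_ord.
apply/permP => x; apply: val_inj => /=; rewrite !hecke_val.
have -> : sleft l' = sright l by apply: val_inj.
have n1 : (sleft l == sright l) = false by rewrite -val_eqE /=; lia.
have n2 : (sleft l == sright l') = false by rewrite -val_eqE /=; lia.
have n3 : (sright l == sright l') = false by rewrite -val_eqE /=; lia.
rewrite ![sright l' == _]eq_sym ![sright l == sleft l]eq_sym n1 n2 n3 !eqxx.
case: (eqVneq x (sleft l)) => [->|x1]; first by rewrite ?n1 ?n2; lia.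
case: (eqVneq x (sright l)) => [_|x2]; first by lia.
by case: (eqVneq x (sright l')) => // _; lia.
Qed.

End HeckeRelations.

(** * The Yang-Baxter equation and the commutation of rows *)

Section DemazureOperators.
Variables (m : nat) (R : idomainType).
Implicit Types (u : 'S_m) (f g : {ffun 'S_m -> R}) (x y a b : R) (k d i : nat).

(** The factor [1 - x e_k], acting on functions by pulling back right multiplication; in a
    composite, the outermost operator is the first letter. *)
Definition hop k x f : {ffun 'S_m -> R} := [ffun u => f u - x * f (hmul u k)].

Definition lin a b f g : {ffun 'S_m -> R} := [ffun u => a * f u + b * g u].

(* The factors [hop] for the letters i + d - 1, ..., i, in that order. *)
Fixpoint rowop d i x f : {ffun 'S_m -> R} :=
  if d is d'.+1 then rowop d' i.+1 x (hop i x f) else f.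

Lemma hop_lin k x a b f g : hop k x (lin a b f g) = lin a b (hop k x f) (hop k x g).
Proof. by apply/ffunP => u; rewrite !ffunE; ring. Qed.

Lemma rowop_lin d i x a b f g : rowop d i x (lin a b f g) = lin a b (rowop d i x f) (rowop d i x g).
Proof. by elim: d i f g => //= d IH i f g; rewrite hop_lin IH. Qed.

Lemma hop_comm k k' x y f : (k.+1 < k')%N -> hop k x (hop k' y f) = hop k' y (hop k x f).
Proof.
by move=> lt; apply/ffunP => u; rewrite !ffunE (hmul_comm u lt); ring.
Qed.

Lemma hop_rowop k d i x y f : (k.+1 < i)%N ->
  hop k x (rowop d i y f) = rowop d i y (hop k x f).
Proof.
elim: d i f => //= d IH i f ki; rewrite IH; last by lia.
by rewrite hop_comm.
Qed.

(** Since [e_k] is idempotent, [1 - y e_k] has inverse [1 + y / (1 - y) e_k], here multiplied by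
    [1 - y]. *)
Lemma hop_unit k y f : lin (1 - y) 0 f f = hop k y [ffun u => (1 - y) * f u + y * f (hmul u k)].
Proof. by apply/ffunP => u; rewrite !ffunE hmul_id; ring. Qed.

Definition yb k x y f : {ffun 'S_m -> R} := hop k x (hop k.+1 y (hop k y f)).

(* A form of the Yang-Baxter equation, with the inverse of [hop k.+1 y] cleared of
   its denominator [1 - y]. *)
Lemma yang_baxter k x y f : (k.+1 < m.-1)%N ->
  [ffun u => (1 - x) * ((1 - y) * yb k x y f u + y * yb k x y f (hmul u k.+1))] =
  [ffun u => (1 - y) * ((1 - x) * yb k y x f u + x * yb k y x f (hmul u k.+1))]
    :> {ffun 'S_m -> R}.
Proof.
move=> km; apply/ffunP => u; rewrite /yb !ffunE.
by rewrite -!(hmul_braid _ km) !hmul_id -?(hmul_braid _ km) ?hmul_id; ring.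
Qed.

(** The last letter of the first row commutes past all but the last two letters of the second,
    leaving [yb]. Inserting [hop i.+1 b] and its inverse completes the second row without its letter
    [i]; induction exchanges the shortened rows and [yang_baxter] the remaining factor. *)
Lemma rowop_comm d i x y f : 1 - x != 0 -> 1 - y != 0 -> (i + d <= m.-1)%N ->
  rowop d i x (rowop d i y f) = rowop d i y (rowop d i x f).
Proof.
move=> x1 y1; elim: d i f => [//|[|d] IH] i f di.
  by apply/ffunP => u; rewrite /= !ffunE !hmul_id; ring.
have E a b : rowop d.+2 i a (rowop d.+2 i b f)
    = rowop d.+1 i.+1 a (rowop d i.+2 b (yb i a b f)) by rewrite /= hop_rowop.
have E2 a b (g : {ffun 'S_m -> R}) : lin (1 - b) 0 (rowop d.+1 i.+1 a (rowop d i.+2 b g))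
      (rowop d.+1 i.+1 a (rowop d i.+2 b g)) =
    rowop d.+1 i.+1 a (rowop d.+1 i.+1 b [ffun u => (1 - b) * g u + b * g (hmul u i.+1)]).
  by rewrite -rowop_lin -rowop_lin (hop_unit i.+1).
have sc a b (g : {ffun 'S_m -> R}) : lin a 0 (lin b 0 g g) (lin b 0 g g) = [ffun u => a * (b * g u)].
  by apply/ffunP => u; rewrite !ffunE; ring.
have H : lin (1 - x) 0 (lin (1 - y) 0 (rowop d.+2 i x (rowop d.+2 i y f)) (rowop d.+2 i x (rowop d.+2 i y f)))
             (lin (1 - y) 0 (rowop d.+2 i x (rowop d.+2 i y f)) (rowop d.+2 i x (rowop d.+2 i y f)))
       = lin (1 - y) 0 (lin (1 - x) 0 (rowop d.+2 i y (rowop d.+2 i x f)) (rowop d.+2 i y (rowop d.+2 i x f)))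
             (lin (1 - x) 0 (rowop d.+2 i y (rowop d.+2 i x f)) (rowop d.+2 i y (rowop d.+2 i x f))).
  rewrite !E !E2 -!rowop_lin IH; last by lia.
  congr (rowop _ _ _ (rowop _ _ _ _)).
  have km : (i.+1 < m.-1)%N by lia.
  have := yang_baxter x y f km => /ffunP yb1; apply/ffunP => u.
  by have := yb1 u; rewrite !ffunE => e; rewrite !mul0r !addr0.
apply/ffunP => u; move/ffunP/(_ u): H; rewrite !sc !ffunE => e.
by apply: (mulfI y1); apply: (mulfI x1); rewrite e mulrCA.
Qed.

(* The rows r, r+1, ... of a pipe dream, with letters below M. *)
Fixpoint rowsop (M r : nat) (xs : seq R) f : {ffun 'S_m -> R} :=
  if xs is x :: xs' then rowop (M - r) r x (rowsop M r.+1 xs' f) else f.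

Lemma rowsop_lin M r xs a b f g :
  rowsop M r xs (lin a b f g) = lin a b (rowsop M r xs f) (rowsop M r xs g).
Proof. by elim: xs r => //= x xs IH r; rewrite IH rowop_lin. Qed.

Lemma rowsop_cat M r xs ys f :
  rowsop M r (xs ++ ys) f = rowsop M r xs (rowsop M (r + size xs) ys f).
Proof. by elim: xs r => [|x xs IH] r /=; rewrite ?addn0 // IH addSnnS. Qed.

Lemma hop_rowsop M k x r xs f : (k.+1 < r)%N ->
  rowsop M r xs (hop k x f) = hop k x (rowsop M r xs f).
Proof. by elim: xs r => //= y xs IH r kr; rewrite IH ?hop_rowop //; lia. Qed.

(** The lower of the two rows stops at letter [i + 1], where [i = size xs]. The extra letter [i]
    commutes past the rows further down and gives it the same letters as the row above, so
    [rowop_comm] applies. *)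
Lemma rowsop_swap M xs x y ys f : 1 - x != 0 -> 1 - y != 0 ->
  (size xs < M)%N -> (M <= m.-1)%N ->
  rowsop M 0 (xs ++ x :: y :: ys) (hop (size xs) y f) =
  rowsop M 0 (xs ++ y :: x :: ys) (hop (size xs) x f).
Proof.
move=> x1 y1 iM Mm; rewrite !rowsop_cat /= add0n !hop_rowsop //.
set g := rowsop _ _ ys f; set i := size xs in iM *.
have e a : rowop (M - i.+1) i.+1 a (hop i a g) = rowop (M - i) i a g.
  by have -> : (M - i = (M - i.+1).+1)%N by lia.
by rewrite !e rowop_comm //; lia.
Qed.

End DemazureOperators.

(** * Expanding the product of rows over pipe dreams *)

Section PipeDreamExpansion.
Variable n : nat.
Local Notation R := {mpoly int[n]}.
Local Notation m := (n + n)%N.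
Implicit Types (f g : {ffun 'S_m -> R}) (q : 'I_n * 'I_n) (P : {set 'I_n * 'I_n}).

Definition boxop q f := hop (q.1 + q.2) ('X_(q.1) : R) f.

(** Each factor [1 - x e_k] contributes [1] or [- x e_k]; [P] collects the boxes of the second
    kind. *)
Lemma boxop_expand (L : seq ('I_n * 'I_n)) f u : uniq L ->
  foldr boxop f L u = \sum_(P : {set 'I_n * 'I_n} | P \subset [set q in L])
    (\prod_(q in P) (- 'X_(q.1))) *
      f (foldl (@hecke_mul m) u [seq box_label q | q <- L & q \in P]).
Proof.
elim: L u => [|q L IH] u /=.
  rewrite (big_pred1 set0) => [_|P]; first by rewrite big_set0 mul1r.
  by rewrite /= -subset0; congr (_ \subset _); apply/setP => q; rewrite !inE.
move=> /andP[qL uL]; rewrite /boxop ffunE -/boxop.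
have -> : hmul u (q.1 + q.2) = hecke_mul u (box_label q) by rewrite -hmul_ord.
rewrite !IH // [RHS](bigID (fun P : {set _} => q \in P)) /= addrC; congr (_ + _); last first.
  rewrite mulr_sumr -sumrN.
  rewrite [RHS](reindex_onto (fun P : {set _} => q |: P) (fun P => P :\ q)) /=; last first.
    by move=> P /andP[_ qP]; rewrite setD1K.
  apply: eq_big => [P|P PL].
    rewrite setU11 andbT; apply/idP/andP => [PL|[/subsetP h /eqP e]].
      have qP : q \notin P by apply: contra qL => /(subsetP PL); rewrite inE.
      split; last by rewrite setU1K.
      by rewrite set_cons setUS.
    apply/subsetP => x xP; have := h x; rewrite !inE xP orbT => /(_ isT).
    by case/orP => // /eqP ex; move: xP; rewrite -e !inE ex eqxx.
  have qP : q \notin P by apply: contra qL => /(subsetP PL); rewrite inE.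
  rewrite setU11 big_setU1 //= mulNr mulrA mulNr; congr (- (_ * f (foldl _ _ _))).
  by congr map; apply: eq_in_filter => x xL; rewrite !inE; case: eqP => // ex; rewrite -ex xL in qL.
apply: eq_big => [P|P PL].
  apply/idP/andP => [PL|[/subsetP h qP]].
    split; first by apply: subset_trans PL _; rewrite set_cons subsetUr.
    by apply: contra qL => /(subsetP PL); rewrite inE.
  apply/subsetP => x xP; have := h x xP; rewrite !inE => /orP[/eqP ex|//].
  by rewrite -ex xP in qP.
have qP : q \notin P by apply: contra qL => /(subsetP PL); rewrite inE.
by rewrite (negPf qP).
Qed.

Lemma rowop_foldr (d i : nat) (x : R) f :
  rowop d i x f = foldr (fun k g => hop k x g) f (rev (iota i d)).
Proof.
by elim: d i f => [//|d IH] i f /=; rewrite rev_cons foldr_rcons IH.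
Qed.

Lemma rowsop_reading f :
  rowsop n.-1 0 [seq 'X_i : R | i <- enum 'I_n] f =
  foldr boxop f [seq q : 'I_n * 'I_n <- reading n | (q.1 + q.2 < n.-1)%N].
Proof.
have FI (a N : nat) : [seq k <- iota 0 N | (a + k < N.-1)%N] = iota 0 (N.-1 - a).
  have {1}-> : iota 0 N = iota 0 (N.-1 - a) ++ iota (N.-1 - a) (N - (N.-1 - a)).
    by rewrite -iotaD; congr iota; lia.
  rewrite filter_cat [X in _ ++ X](_ : _ = [::]) ?cats0.
    by apply/all_filterP/allP => k; rewrite mem_iota; lia.
  by apply/eqP; rewrite -[_ == _]negbK -has_filter; apply/hasPn => k; rewrite mem_iota; lia.
have H (s : seq 'I_n) r : map val s = iota r (size s) ->
    rowsop n.-1 r [seq 'X_i : R | i <- s] f =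
    foldr boxop f [seq q : 'I_n * 'I_n <- [seq (i, k) | i <- s, k <- rev (enum 'I_n)] | (q.1 + q.2 < n.-1)%N].
  elim: s r => //= i s IH r [ir es]; rewrite filter_cat foldr_cat -(IH _ es) -ir.
  set g := rowsop _ _ _ _.
  rewrite rowop_foldr filter_map foldr_map /boxop /=.
  have -> : [seq k : 'I_n <- rev (enum 'I_n) | (i + k < n.-1)%N] = rev [seq k : 'I_n <- enum 'I_n | (i + k < n.-1)%N].
    by rewrite filter_rev.
  have -> : iota i (n.-1 - i) = [seq (i + k)%N | k : 'I_n <- [seq k : 'I_n <- enum 'I_n | (i + k < n.-1)%N]].
    have -> : [seq (i + k)%N | k : 'I_n <- [seq k : 'I_n <- enum 'I_n | (i + k < n.-1)%N]] =
       [seq (i + k)%N | k <- [seq k <- map val (enum 'I_n) | (i + k < n.-1)%N]].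
      by rewrite filter_map -map_comp.
    rewrite val_enum_ord -[iota i _]/(iota i (n.-1 - i)) -{1}[nat_of_ord i]addn0 iotaDl; congr map.
    by rewrite FI.
  by rewrite -map_rev foldr_map.
by apply: H; rewrite val_enum_ord size_enum_ord.
Qed.

End PipeDreamExpansion.

(** * The divided difference recursion for pipe dreams *)

Section GrothendieckPipeDreams.
Variable n : nat.
Local Notation R := {mpoly int[n]}.
Local Notation m := (n + n)%N.
Implicit Types (f g : {ffun 'S_m -> R}) (q : 'I_n * 'I_n) (P : {set 'I_n * 'I_n})
  (w v : 'S_n) (i : 'I_n.-1).

(** Values from [n] on are in no inversion of [extend w], so by [posE] they never leave their
    places, whereas a letter [l >= n.-1] would compare the value [l + 1] with another. *)
Lemma word_extend_lt (u : 'S_m) (s : seq 'I_m.-1) w : foldl (@hecke_mul m) u s = extend w ->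
  all (fun l : 'I_m.-1 => (l < n.-1)%N) s.
Proof.
elim: s u => //= l s IH u e; rewrite (IH _ e) andbT ltnNge; apply/negP => nl.
set u' := hecke_mul u l in e.
have bW (y x : 'I_m) : vinv u' y x -> exists2 b, b \in rothe w & (y, x) = value_pair w b.
  by move=> h; apply/vinv_extendP; rewrite -e vinv_foldl h.
have ln : (n <= l.+1)%N by move: nl; clear; lia.
have fix_r : u' (sright l) = sright l.
  apply: (@perm_inj _ (u'^-1)%g); rewrite permK; apply: ord_inj.
  have := posE u' (sright l).
  have -> : [set x | vinv u' (sright l) x] = set0.
    apply/setP => x; rewrite !inE; apply/negP => /bW[b _ [h _]].
    by move: h (ltn_ord (w b.1)) ln; clear => /= h; lia.
  have -> : [set x | vinv u' x (sright l)] = set0.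
    apply/setP => x; rewrite !inE; apply/negP => /bW[b _ [_ h]].
    by move: h (ltn_ord b.2) ln; clear => /= h; lia.
  by rewrite cards0 !addn0 => ->.
have : vinv u' (cross u l).1 (cross u l).2.
  by rewrite vinv_hecke -surjective_pairing eqxx orbT.
have [_ <-] := hecke_crossE u l; rewrite -/u' fix_r => /bW[b _ [_ h]].
by move: h (ltn_ord b.2) ln; clear => /= h; lia.
Qed.

Lemma demazure_staircase P w q : demazure P = extend w -> q \in P -> (q.1 + q.2 < n.-1)%N.
Proof.
move=> /word_extend_lt/allP h qP; have := h (box_label q); apply.
by apply: map_f; rewrite mem_filter qP; apply: mem_reading.
Qed.

(** The Grothendieck polynomial up to the sign [(-1) ^+ ninv w], kept out so that this is a plain
    coefficient of the product of rows. *)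
Definition pd_poly w : R :=
  \sum_(P : {set 'I_n * 'I_n} | demazure P == extend w) \prod_(q in P) (- 'X_(q.1)).

(** Applying a product of [hop] operators to [ind V] and evaluating at 1 extracts the coefficient of
    [V]. *)
Definition ind (V : 'S_m) : {ffun 'S_m -> R} := [ffun u => (u == V)%:R].

Definition allrows f : R := rowsop n.-1 0 [seq 'X_a : R | a <- enum 'I_n] f 1%g.

Lemma reading_uniq : uniq (reading n).
Proof.
apply: (@pairwise_uniq _ (@reads_before n)); last exact: reading_pairwise.
by move=> q; apply/negP => h; have := reads_before_asym h; rewrite h.
Qed.

Lemma allrows_ind w : allrows (ind (extend w)) = pd_poly w.
Proof.
rewrite /allrows rowsop_reading boxop_expand; last exact: filter_uniq reading_uniq.
rewrite /pd_poly big_mkcond [RHS]big_mkcond; apply: eq_bigr => P _.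
case: ifP => [/subsetP PS|/negP PS]; last first.
  case: ifP => // /eqP e; case: PS; apply/subsetP => q qP.
  by rewrite inE mem_filter mem_reading (demazure_staircase e qP).
have -> : foldl (@hecke_mul m) 1%g [seq box_label q | q : 'I_n * 'I_n <-
    [seq q : 'I_n * 'I_n <- reading n | (q.1 + q.2 < n.-1)%N] & q \in P] = demazure P.
  rewrite /demazure pd_wordE -filter_predI; congr (foldl _ _ (map _ _)).
  apply: eq_filter => q /=; case qP : (q \in P) => //=.
  by have := PS _ qP; rewrite inE mem_filter => /andP[].
by rewrite ffunE; case: eqP => _; rewrite ?mulr1 ?mulr0.
Qed.

Definition msymf (s : 'S_n) f : {ffun 'S_m -> R} := [ffun u => msym s (f u)].

Lemma msymf_hop s k x f : msymf s (hop k x f) = hop k (msym s x) (msymf s f).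
Proof. by apply/ffunP => u; rewrite !ffunE msymB msymM. Qed.

Lemma msymf_rowsop s M r xs f :
  msymf s (rowsop M r xs f) = rowsop M r (map (msym s) xs) (msymf s f).
Proof.
elim: xs r f => //= x xs IH r f; rewrite -IH; move: (rowsop _ _ xs f) => {}f.
by move: (M - r)%N => d; elim: d r f => //= d IHd r f; rewrite IHd msymf_hop.
Qed.

Lemma msymf_ind s V : msymf s (ind V) = ind V.
Proof. by apply/ffunP => u; rewrite !ffunE; case: eqP => _; rewrite ?msym1 ?msym0. Qed.

Lemma enum_ord_adj i : enum 'I_n =
  take i (enum 'I_n) ++ sleft i :: sright i :: drop i.+2 (enum 'I_n).
Proof.
rewrite -{1}(cat_take_drop i (enum 'I_n)); congr cat.
have lt := ltn_ord (sright i); have lt' := ltn_ord (sleft i).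
rewrite (drop_nth (sleft i)) ?size_enum_ord // (nth_ord_enum _ (sleft i)); congr cons.
by rewrite (drop_nth (sleft i)) ?size_enum_ord // (nth_ord_enum _ (sright i)).
Qed.

Lemma X_neq1 (a : 'I_n) : 1 - 'X_a != 0 :> R.
Proof.
rewrite subr_eq0; apply/negP => /eqP /(congr1 (mcoeff U_(a)%MM)).
by rewrite mcoeff1 mcoeffXU eqxx mnm1_eq0.
Qed.

(* The two rows i, i+1 followed by the letter i form a symmetric product. *)
Lemma allrows_hop_sym i f : (forall u, msym (simple i) (f u) = f u) ->
  msym (simple i) (allrows (hop i 'X_(sright i) f)) = allrows (hop i 'X_(sright i) f).
Proof.
move=> fs; have {}fs : msymf (simple i) f = f by apply/ffunP => u; rewrite ffunE fs.
rewrite /allrows; set r1 := rowsop _ _ _ _.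
have -> : msym (simple i) (r1 1%g) = msymf (simple i) r1 1%g by rewrite ffunE.
congr (fun_of_fin _ 1%g); rewrite {}/r1 msymf_rowsop msymf_hop fs msym_simpleR.
have enE := enum_ord_adj i; rewrite {1 2}enE !map_cat /=.
have fixX (a : 'I_n) : a != sleft i -> a != sright i -> msym (simple i) ('X_a : R) = 'X_a.
  by move=> *; rewrite msym_tpermX /simple tpermD // eq_sym.
set p := take _ _; set q := drop _ _.
have hp : map (msym (simple i)) (map (fun a => 'X_a : R) p) = map (fun a => 'X_a : R) p.
  rewrite -map_comp; apply/eq_in_map => a ap; apply: fixX; rewrite -val_eqE /=;
    have := map_f val ap; rewrite map_take val_enum_ord take_iota mem_iota /=; clear; lia.
have hq : map (msym (simple i)) (map (fun a => 'X_a : R) q) = map (fun a => 'X_a : R) q.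
  rewrite -map_comp; apply/eq_in_map => a ap; apply: fixX; rewrite -val_eqE /=;
    have := map_f val ap; rewrite map_drop val_enum_ord drop_iota mem_iota /=; clear; lia.
rewrite hp hq msym_simpleL msym_simpleR.
have sp : size (map (fun a => 'X_a : R) p) = i.
  rewrite size_map size_take size_enum_ord; have hi := ltn_ord i.
  by case: ltnP => // h; move: hi h; clear; lia.
have := @rowsop_swap m R n.-1 (map (fun a => 'X_a : R) p) 'X_(sleft i) 'X_(sright i)
  (map (fun a => 'X_a : R) q) f (X_neq1 _) (X_neq1 _).
rewrite sp => -> //; last by clear; lia.
Qed.

Lemma extendM v w : extend (v * w)%g = (extend v * extend w)%g.
Proof.
apply/permP => x; rewrite permM; case: (split_ordP x) => y ->.
  by rewrite !extendL permM.
by rewrite !extendR.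
Qed.

Fact wide_letter_subproof i : (i < m.-1)%N.
Proof. by have := ltn_ord i; lia. Qed.

Definition wide_letter i : 'I_m.-1 := Ordinal (wide_letter_subproof i).

Lemma sleft_wide i : sleft (wide_letter i) = lshift n (sleft i).
Proof. exact: val_inj. Qed.

Lemma sright_wide i : sright (wide_letter i) = lshift n (sright i).
Proof. exact: val_inj. Qed.

Lemma extend_simple i : extend (simple i) = simple (wide_letter i).
Proof.
apply/permP => x; rewrite /simple sleft_wide sright_wide; case: (split_ordP x) => y ->.
  by rewrite extendL (inj_tperm _ _ _ (@lshift_inj n n)).
by rewrite extendR tpermD // eq_lrshift.
Qed.

Lemma extend_rmul w i : extend (rmul_simple w i) = rmul_simple (extend w) (wide_letter i).
Proof. by rewrite /rmul_simple extendM extend_simple. Qed.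

(** A 0-Hecke letter always leaves a descent, so a permutation ascending at [l] is never its
    result. *)
Lemma hecke_mul_eq (u U : 'S_m) l : (U (sleft l) < U (sright l))%N ->
  (hecke_mul u l == U) = false /\
  (hecke_mul u l == rmul_simple U l) = (u == U) || (u == rmul_simple U l).
Proof.
move=> asc; rewrite hecke_mulE.
have desc : (rmul_simple U l (sright l) < rmul_simple U l (sleft l))%N.
  by rewrite !rmul_simpleE /simple tpermL tpermR.
case: (asc_or_desc u l) => h.
  rewrite h; split.
    apply/eqP => e; move: asc h; rewrite -e !rmul_simpleE /simple tpermL tpermR; clear; lia.
  have -> : (u == rmul_simple U l) = false.
    by apply/eqP => e; move: h desc; rewrite e; clear; lia.
  rewrite orbF; apply/eqP/eqP => [e|-> //].
  by rewrite -(rmul_simpleK u l) e rmul_simpleK.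
rewrite ltnNge (ltnW h) /=.
have -> : (u == U) = false by apply/eqP => e; move: h asc; rewrite e; clear; lia.
by [].
Qed.

(** [allrows_hop_sym] makes both [pd_poly w] and [(1 - y) * pd_poly (rmul_simple w i) - y * pd_poly
    w] symmetric; equating the latter with its image under [simple i] gives the recursion. Its sign
    is opposite to that of [Grothendieck] because the length changes by one. *)
Lemma pd_poly_rec w i : (w (sleft i) < w (sright i))%N ->
  ('X_(sleft i) - 'X_(sright i)) * pd_poly w =
  (1 - 'X_(sleft i)) * msym (simple i) (pd_poly (rmul_simple w i))
  - (1 - 'X_(sright i)) * pd_poly (rmul_simple w i).
Proof.
move=> asc; set x : R := 'X_(sleft i); set y : R := 'X_(sright i).
set W := extend w; set l := wide_letter i.
have ascW : (W (sleft l) < W (sright l))%N.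
  by rewrite sleft_wide sright_wide !extendL.
have lE : nat_of_ord i = l by [].
have hW : hop i y (ind W) = ind W.
  apply/ffunP => u; rewrite !ffunE lE hmul_ord.
  by have [-> _] := hecke_mul_eq u ascW; rewrite mulr0 subr0.
have hV : hop i y (ind (extend (rmul_simple w i))) =
    lin (1 - y) (- y) (ind (extend (rmul_simple w i))) (ind W).
  apply/ffunP => u; rewrite !ffunE lE hmul_ord extend_rmul -/W -/l.
  have [_ ->] := hecke_mul_eq u ascW.
  have ne : W != rmul_simple W l.
    apply/eqP => /permP/(_ (sleft l)); rewrite rmul_simpleE /simple tpermL => /perm_inj e.
    by have := sleft_neq_sright l; rewrite e eqxx.
  case: (eqVneq u W) => [->|_] /=; last by case: (_ == _); rewrite /= ?mulr0n ?mulr1n; ring.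
  by rewrite (negPf ne) /= ?mulr0n ?mulr1n; ring.
have symW : msym (simple i) (pd_poly w) = pd_poly w.
  rewrite -allrows_ind -/W -hW; apply: allrows_hop_sym => u.
  by have /ffunP/(_ u) := msymf_ind (simple i) W; rewrite ffunE.
have ZE : allrows (hop i y (ind (extend (rmul_simple w i)))) =
    (1 - y) * pd_poly (rmul_simple w i) - y * pd_poly w.
  by rewrite hV -!allrows_ind /allrows rowsop_lin ffunE mulNr.
have symV u : msym (simple i) (ind (extend (rmul_simple w i)) u) = ind (extend (rmul_simple w i)) u.
  by have /ffunP/(_ u) := msymf_ind (simple i) (extend (rmul_simple w i)); rewrite ffunE.
have := allrows_hop_sym symV; rewrite -/y ZE msymB !msymM msymB msym1 symW msym_simpleR -/x => e.
transitivity ((1 - x) * msym (simple i) (pd_poly (rmul_simple w i)) -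
   ((1 - x) * msym (simple i) (pd_poly (rmul_simple w i)) - x * pd_poly w) - y * pd_poly w).
  by ring.
by rewrite e; ring.
Qed.

Lemma card_rothe w : #|rothe w| = ninv w.
Proof.
pose g (b : 'I_n * 'I_n) := (b.1, (w^-1)%g b.2).
have gi : injective g by move=> [a b] [a' b'] [-> /perm_inj ->].
rewrite -(card_imset _ gi); apply: eq_card => -[a b]; rewrite !inE /=.
apply/imsetP/andP => [[[i j] + [-> ->]]|[ab wab]].
  by rewrite in_rothe permKV => /andP[].
by exists (a, w b); rewrite ?in_rothe /g /= ?permK // wab.
Qed.

Lemma card_row P (i : 'I_n) : #|[pred q in P | q.1 == i]| = wt P i.
Proof.
rewrite mnmE.
have inj : injective (fun c : 'I_n => (i, c)) by move=> c c' [].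
rewrite -(card_imset _ inj); apply: eq_card => -[a c]; rewrite unfold_in /=.
apply/andP/imsetP => [[h /eqP e]|[c' + [-> ->]]]; last by rewrite inE eqxx.
by subst; exists c; rewrite ?inE.
Qed.

Lemma prod_box_vars P : \prod_(q in P) (- 'X_(q.1)) = (-1) ^+ #|P| * 'X_[wt P] :> R.
Proof.
rewrite -prodr_const; under eq_bigr do rewrite -mulN1r.
rewrite big_split /=; congr (_ * _); rewrite mpolyXE_id.
rewrite (partition_big (fun q : 'I_n * 'I_n => q.1) xpredT) //=.
apply: eq_bigr => i _; rewrite (eq_bigr (fun _ => 'X_i)) => [|q /andP[_ /eqP->] //].
by rewrite prodr_const -card_row.
Qed.

Lemma rothe_w0 q : (q \in rothe (w0 n)) = (q.1 + q.2 < n.-1)%N.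
Proof.
case: q => i j; rewrite in_rothe.
have w0V : ((w0 n)^-1)%g = w0 n.
  apply/permP => x; apply: (@perm_inj _ (w0 n)); rewrite permKV !permE.
  by rewrite rev_ordK.
by rewrite w0V !permE /=; have := ltn_ord i; have := ltn_ord j; clear; lia.
Qed.

Lemma rothe_leq_pd P w : demazure P = extend w -> (#|rothe w| <= #|P|)%N.
Proof.
move=> e; pose t := crossings 1 (pd_word P).
have -> : #|P| = size t.
  have uL : uniq [seq q <- reading n | q \in P] := filter_uniq _ reading_uniq.
  rewrite size_crossings pd_wordE size_map -(card_uniqP uL); apply: eq_card => q.
  by rewrite mem_filter mem_reading andbT.
rewrite cardE -(size_map (value_pair w)); apply: uniq_leq_size.
  by rewrite (map_inj_uniq (@value_pair_inj n w)) enum_uniq.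
move=> _ /mapP[b + ->]; rewrite mem_enum -vinv_value_pair.
by rewrite -e vinv_foldl vinv1.
Qed.

(** A pipe dream for [w0] lies in the staircase and has at least as many boxes as it, so the
    staircase is the only candidate; [b] records whether it is one. *)
Lemma pd_poly_w0 : exists b : bool,
  pd_poly (w0 n) = b%:R * ((-1) ^+ ninv (w0 n) * Grothendieck n (w0 n)).
Proof.
exists (demazure (rothe (w0 n)) == extend (w0 n)).
rewrite Grothendieck_w0.
have -> : \prod_(i < n) 'X_i ^+ (n - i.+1) = 'X_[wt (rothe (w0 n))] :> R.
  rewrite mpolyXE_id; apply: eq_bigr => i _; rewrite mnmE; congr (_ ^+ _).
  have h : (n - i.+1 < n)%N by have := ltn_ord i; clear; lia.
  rewrite -[LHS](card_ord_lt (Ordinal h)); apply: eq_card => k.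
  by rewrite [RHS]inE [LHS]inE rothe_w0 /=; clear; lia.
rewrite -card_rothe -prod_box_vars /pd_poly.
have only P : demazure P == extend (w0 n) -> P = rothe (w0 n).
  move=> /eqP e; apply/eqP; rewrite eqEcard rothe_leq_pd // andbT.
  by apply/subsetP => q qP; rewrite rothe_w0 (demazure_staircase e qP).
case: (boolP (demazure (rothe (w0 n)) == extend (w0 n))) => h.
  rewrite mul1r (big_pred1 (rothe (w0 n))) // => P /=.
  by apply/idP/eqP => [/only //|->].
rewrite mul0r big_pred0 // => P; apply/negP => hP.
by move: h; rewrite -(only _ hP) hP.
Qed.

Lemma no_asc w : (forall i, (w (sright i) < w (sleft i))%N) -> w = w0 n.
Proof.
move=> h; have e : (w * w0 n = 1)%g.
  apply: no_desc => i; rewrite !permM !permE /=.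
  by have := h i; have := ltn_ord (w (sleft i)); clear; lia.
apply/permP => x; apply: (@perm_inj _ (w0 n)); have := congr1 (fun s : 'S_n => s x) e.
by rewrite permM perm1 => ->; rewrite !permE rev_ordK.
Qed.

Lemma X_sub_neq0 i : 'X_(sleft i) - 'X_(sright i) != 0 :> R.
Proof.
rewrite subr_eq0; apply/negP => /eqP /(congr1 (mcoeff U_(sleft i)%MM)).
by rewrite !mcoeffXU eqxx eq_sym (negPf (sleft_neq_sright i)) => /eqP.
Qed.

Lemma ninv_le_sq w : (ninv w <= n * n)%N.
Proof. by rewrite (leq_trans (max_card _)) // card_prod card_ord. Qed.

Lemma Grothendieck_pd w : Grothendieck n w = (-1) ^+ ninv w * pd_poly w.
Proof.
have [b eb] := pd_poly_w0.
have sgn k : ((-1) ^+ k * (-1) ^+ k : R) = 1 by rewrite -exprMn mulrNN mulr1 expr1n.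
have H v : pd_poly v = b%:R * ((-1) ^+ ninv v * Grothendieck n v).
  have [k] := ubnP (n * n - ninv v)%N; elim: k v => // k IH v vk.
  case: (pickP (fun i => v (sleft i) < v (sright i))%N) => [i asc|na]; last first.
    suff -> : v = w0 n by [].
    by apply: no_asc => i; have := na i; case: (asc_or_desc v i) => // ->.
  have e := ninv_asc asc; have le := ninv_le_sq (rmul_simple v i).
  have {}IH : pd_poly (rmul_simple v i) =
      - (b%:R * (-1) ^+ ninv v) * Grothendieck n (rmul_simple v i).
    by rewrite IH ?e ?exprS; [ring | move: vk le; rewrite e; clear; lia].
  apply: (mulfI (X_sub_neq0 i)); rewrite (pd_poly_rec asc) IH.
  have mc : msym (simple i) (b%:R * (-1) ^+ ninv v : R) = b%:R * (-1) ^+ ninv v.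
    rewrite -signr_odd; case: (odd _); case: b {eb IH};
      by rewrite /= ?mul1r ?mul0r ?expr0 ?expr1 ?msymN ?msym1 ?msym0.
  have := ddiffE i ((1 - 'X_(sright i)) * Grothendieck n (rmul_simple v i)).
  rewrite -(Grothendieck_rec asc) !msymM msymN mc msymB msym1 msym_simpleR => eG.
  set c : R := b%:R * (-1) ^+ ninv v.
  transitivity (c * (('X_(sleft i) - 'X_(sright i)) * Grothendieck n v)); last by rewrite /c; ring.
  by rewrite eG; ring.
(* [b] need not be computed: [b = false] would make [pd_poly 1 = 1] vanish. *)
have b1 : b.
  have := H 1%g; case: (b) => //; rewrite mul0r => /(congr1 (mcoeff 0%MM)).
  rewrite /pd_poly (bigD1 set0) /=; last first.
    rewrite /demazure pd_wordE [X in map _ X](_ : _ = [::]) /=; last first.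
      by apply/eqP; rewrite -[_ == _]negbK -has_filter; apply/hasPn => q _; rewrite inE.
    apply/eqP/permP => x; rewrite perm1; case: (split_ordP x) => z ->.
      by rewrite extendL perm1.
    by rewrite extendR.
  rewrite big_set0 big_pred0 ?addr0 ?mcoeff1 ?mcoeff0 ?eqxx // => P.
  apply/negP => /andP[/eqP e /set0Pn[q qP]].
  have : box_label q \in pd_word P by apply: map_f; rewrite mem_filter qP; apply: mem_reading.
  case E : (crossings 1 (pd_word P)) => [|[y x] t].
    by have := size_crossings 1 (pd_word P); rewrite E; case: (pd_word P).
  have : vinv (extend (1%g : 'S_n)) y x by rewrite -e vinv_foldl vinv1 E mem_head.
  move=> /vinv_extendP[[i j]]; rewrite in_rothe invg1 !perm1 => /andP[]; clear; lia.
by rewrite H b1 mul1r mulrA sgn mul1r.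
Qed.

End GrothendieckPipeDreams.

(** Through this, the equality of weights in [wt_pd] also gives equal numbers of boxes, hence equal
    signs. *)
Lemma card_wt n (P : {set 'I_n * 'I_n}) : #|P| = mdeg (wt P).
Proof.
rewrite mdegE -sum1_card (partition_big (fun q : 'I_n * 'I_n => q.1) xpredT) //=.
by apply: eq_bigr => i _; rewrite sum1_card -card_row.
Qed.

Lemma exprz_subnat (a b : nat) : (-1 : int) ^ (a%:Z - b%:Z) = (-1) ^+ a * (-1) ^+ b.
Proof.
by rewrite exprzDr ?unitrN1 // -exprz_inv invrN1.
Qed.

Section Main.
Variables (n : nat) (w : 'S_n).
Hypothesis hw : avoids321 w.

Lemma signed_term_dg T : svt w T ->
  signed_term w (dg T) = (-1) ^+ ninv w * \prod_(q in pd w T) (- 'X_(q.1)).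
Proof.
move=> sT; rewrite prod_box_vars /signed_term coxlenE exprz_subnat !card_wt (wt_pd hw sT).
by rewrite -mul_mpolyC mulrA rmorphM !rmorphXn !rmorphN1 /= [X in X * _ = _]mulrC.
Qed.

Lemma Grothendieck_KKoh : Grothendieck n w = \sum_(D in KKoh (rothe w)) signed_term w D.
Proof.
rewrite Grothendieck_pd /pd_poly KKohE // big_imset /=; last first.
  by move=> T T'; rewrite !inE; apply: dg_inj.
rewrite -big_set pd_imset // big_imset /=; last first.
  by move=> T T'; rewrite !inE; apply: pd_inj.
rewrite mulr_sumr; apply: eq_bigr => T; rewrite inE => sT.
by rewrite signed_term_dg.
Qed.

Lemma gcoef_KKoh gamma : gcoef w gamma = #|KKoh_wt w gamma|.
Proof.
pose V := [set T | svt w T & wt (pd w T) == gamma].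
have -> : gcoef w gamma = #|[set pd w T | T in V]|.
  congr #|pred_of_set _|; apply/setP => P; rewrite inE; apply/andP/imsetP.
    move=> [h g]; have : P \in [set P | demazure P == extend w] by rewrite inE.
    rewrite pd_imset // => /imsetP[T]; rewrite inE => sT eP.
    by exists T; rewrite // inE sT -eP.
  move=> [T]; rewrite inE => /andP[sT g] ->.
  by rewrite (demazure_pd hw sT) eqxx.
have -> : KKoh_wt w gamma = [set dg T | T in V].
  apply/setP => D; rewrite inE KKohE //; apply/andP/imsetP.
    move=> [/imsetP[T]]; rewrite inE => sT -> g.
    by exists T => //; rewrite inE sT (wt_pd hw sT).
  move=> [T]; rewrite inE => /andP[sT g] ->; rewrite -(wt_pd hw sT) g.
  by split => //; apply: imset_f; rewrite inE.
have svtV T : T \in V -> svt w T by rewrite inE => /andP[].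
rewrite !card_in_imset // => T T' /svtV sT /svtV sT'; first exact: dg_inj sT sT'.
exact: (pd_inj hw sT sT').
Qed.

End Main.

Theorem theorem5p1 (n : nat) (w : 'S_n) (hw : avoids321 w) :
  (forall gamma : 'X_{1..n},
     gcoef w gamma = #|KKoh_wt w gamma| /\
     #|KKoh_wt w gamma| = #|tKKoh_wt w gamma|) /\
  (Grothendieck n w = \sum_(D in KKoh (rothe w)) signed_term w D /\
   \sum_(D in KKoh (rothe w)) signed_term w D
     = \sum_(D in tKKoh (rothe w)) signed_term w D).
Proof.
rewrite (tKKohE hw); split=> [gamma|]; last by rewrite -Grothendieck_KKoh.
by rewrite gcoef_KKoh // /tKKoh_wt tKKohE.
Qed.
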